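(* For any two words $w_1,w_2$ in $\mathcal B_n^*$ (resp. in $\mathcal D_n^*$), $w_1$ and $w_2$ lie in the same connected component of $G_n^B$ (resp. $G_n^D$) if and only if $Q^B(w_1)=Q^B(w_2)$ (resp. $Q^D(w_1)=Q^D(w_2)$).
   Context: Fix $n\ge2$. Alphabets $\mathcal B_n=\{1\prec\cdots\prec n\prec0\prec\bar n\prec\cdots\prec\bar1\}$, $\mathcal D_n=\{1\prec\cdots\prec n-1\prec n,\bar n\prec\overline{n-1}\prec\cdots\prec\bar1\}$ ($n,\bar n$ incomparable). Vector crystals: $\mathcal B_n$: arrows $i\xrightarrow{i}i+1$, $\overline{i+1}\xrightarrow{i}\bar i$ ($i<n$), $n\xrightarrow{n}0\xrightarrow{n}\bar n$; $\mathcal D_n$: $i\xrightarrow{i}i+1$, $\overline{i+1}\xrightarrow{i}\bar i$ ($i<n$), $n-1\xrightarrow{n}\bar n$, $n\xrightarrow{n}\overline{n-1}$. Tensor rule: $\tilde f_i(u\otimes v)=\tilde f_iu\otimes v$ if $\varphi_i(u)>\varepsilon_i(v)$, else $u\otimes\tilde f_iv$; $\tilde e_i(u\otimes v)=u\otimes\tilde e_iv$ if $\varphi_i(u)<\varepsilon_i(v)$, else $\tilde e_iu\otimes v$; words identified with tensors, giving $G_n^B$, $G_n^D$. $w_1\sim w_2$: same position ($w_j=\tilde f_{i_1}\cdots\tilde f_{i_r}w_j^0$) in isomorphic components with highest weight vertices $w_j^0$. Columns of type $B$: letters of $\mathcal B_n$ strictly increasing top to bottom except $0$ may repeat; type $D$: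 letters $x_1..x_l$ of $\mathcal D_n$ with $x_{i+1}\not\preceq x_i$. Tabloid $T=C_1\cdots C_r$, $h(C_1)\ge\cdots\ge h(C_r)$, diagram $Y$, reading $\mathrm w(C_r)\cdots\mathrm w(C_1)$. $T_Y$: columns of height $k$ filled $1,\dots,k$; $T_Y^-$: same but height-$n$ columns filled $1,\dots,n-1,\bar n$. Type $B$ orthogonal tableau of shape $Y$: $\mathrm w(T)$ in the component of $\mathrm w(T_Y)$. Type $D$: $\mathrm w(T)$ in the component of $\mathrm w(T_Y)$ (shape $(Y,+)$, or $(Y,0)$ if $Y$ has no height-$n$ column) or of $\mathrm w(T_Y^-)$ (shape $(Y,-)$). $P(w)$ is the unique orthogonal tableau with $\mathrm w(P(w))\sim w$; for $w=x_1\cdots x_l$, $Q^B(w)$ (resp. $Q^D(w)$) is the sequence of shapes of $P(x_1),P(x_1x_2),\dots,P(x_1\cdots x_l)$. *)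

(* Defs.v *)
From Stdlib Require Import Relation_Operators ClassicalEpsilon.
From mathcomp Require Import all_boot.

Set Implicit Arguments.
Unset Strict Implicit.
Unset Printing Implicit Defensive.

(* Letters: L i = i (1 <= i <= n), Z = 0 (type B only), Bar i = \bar i *)
Inductive letter := L of nat | Z | Bar of nat.

Definition letter_eqb (x y : letter) : bool :=
  match x, y with
  | L i, L j => i == j
  | Z, Z => true
  | Bar i, Bar j => i == j
  | _, _ => false
  end.

Definition word := seq letter.
Definition column := seq letter.   (* read from top to bottom *)
Definition tabloid := seq column.

(* A vector crystal: rank n, partial Kashiwara operators on letters. *)
Record vcrystal := VCrystal {
  cn : nat;
  cf : nat -> letter -> option letter;
  ce : nat -> letter -> option letter
}.

Definition fB (n i : nat) (x : letter) : option letter :=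
  if (0 < i) && (i < n) then
    match x with
    | L j => if j == i then Some (L i.+1) else None
    | Bar j => if j == i.+1 then Some (Bar i) else None
    | Z => None
    end
  else if i == n then
    match x with
    | L j => if j == n then Some Z else None
    | Z => Some (Bar n)
    | Bar _ => None
    end
  else None.

Definition eB (n i : nat) (x : letter) : option letter :=
  if (0 < i) && (i < n) then
    match x with
    | L j => if j == i.+1 then Some (L i) else None
    | Bar j => if j == i then Some (Bar i.+1) else None
    | Z => None
    end
  else if i == n then
    match x with
    | Z => Some (L n)
    | Bar j => if j == n then Some Z else None
    | L _ => None
    end
  else None.

Definition fD (n i : nat) (x : letter) : option letter :=
  if (0 < i) && (i < n) then
    match x with
    | L j => if j == i then Some (L i.+1) else None
    | Bar j => if j == i.+1 then Some (Bar i) else None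
    | Z => None
    end
  else if i == n then
    match x with
    | L j => if j == n.-1 then Some (Bar n)
             else if j == n then Some (Bar n.-1) else None
    | _ => None
    end
  else None.

Definition eD (n i : nat) (x : letter) : option letter :=
  if (0 < i) && (i < n) then
    match x with
    | L j => if j == i.+1 then Some (L i) else None
    | Bar j => if j == i then Some (Bar i.+1) else None
    | Z => None
    end
  else if i == n then
    match x with
    | Bar j => if j == n then Some (L n.-1)
               else if j == n.-1 then Some (L n) else None
    | _ => None
    end
  else None.

Definition cB (n : nat) : vcrystal := VCrystal n (fB n) (eB n).
Definition cD (n : nat) : vcrystal := VCrystal n (fD n) (eD n).

Definition validB (n : nat) (x : letter) : bool :=
  match x with L i | Bar i => (0 < i) && (i <= n) | Z => true end.
Definition validD (n : nat) (x : letter) : bool :=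
  match x with L i | Bar i => (0 < i) && (i <= n) | Z => false end.

Section Crystal.
Variable C : vcrystal.

(* string length of a letter (strings in the vector crystals have length <= 2,
   so a fuel of 3 computes it exactly) *)
Fixpoint str_len (g : letter -> option letter) (k : nat) (x : letter) : nat :=
  match k with
  | 0 => 0
  | k'.+1 => match g x with Some y => (str_len g k' y).+1 | None => 0 end
  end.

Definition phil (i : nat) (x : letter) : nat := str_len (cf C i) 3 x.
Definition epsl (i : nat) (x : letter) : nat := str_len (ce C i) 3 x.

(* words x_1 ... x_l identified with x_1 (x) (x_2 (x) ... (x) x_l) *)
Fixpoint epsw (i : nat) (w : word) : nat :=
  match w with
  | [::] => 0
  | x :: r => epsl i x + (epsw i r - phil i x)   (* max(eps x, eps r + eps x - phi x) *)
  end.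

Fixpoint phiw (i : nat) (w : word) : nat :=
  match w with
  | [::] => 0
  | x :: r => phiw i r + (phil i x - epsw i r)   (* max(phi r, phi x + phi r - eps r) *)
  end.

Fixpoint fw (i : nat) (w : word) : option word :=
  match w with
  | [::] => None
  | x :: r => if epsw i r < phil i x then omap (fun y => y :: r) (cf C i x)
              else omap (cons x) (fw i r)
  end.

Fixpoint ew (i : nat) (w : word) : option word :=
  match w with
  | [::] => None
  | x :: r => if phil i x < epsw i r then omap (cons x) (ew i r)
              else omap (fun y => y :: r) (ce C i x)
  end.

Definition edge (u v : word) : Prop :=
  exists i, 1 <= i <= cn C /\ fw i u = Some v.

Definition conn : word -> word -> Prop := clos_refl_sym_trans word edge.

Definition highest (h : word) : Prop :=
  forall i, 1 <= i <= cn C -> ew i h = None.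

Definition iso_comp (h1 h2 : word) : Prop :=
  exists psi : word -> word,
    (forall u, conn h1 u -> conn h2 (psi u)) /\
    (forall u u', conn h1 u -> conn h1 u' -> psi u = psi u' -> u = u') /\
    (forall v, conn h2 v -> exists u, conn h1 u /\ psi u = v) /\
    (forall u i, conn h1 u -> 1 <= i <= cn C -> fw i (psi u) = omap psi (fw i u)).

Definition fseq (s : seq nat) (h : word) : option word :=
  foldr (fun i o => obind (fw i) o) (Some h) s.

Definition sim (w1 w2 : word) : Prop :=
  exists h1 h2 (s : seq nat),
    highest h1 /\ highest h2 /\ conn h1 w1 /\ conn h2 w2 /\ iso_comp h1 h2 /\
    fseq s h1 = Some w1 /\ fseq s h2 = Some w2.

End Crystal.

Fixpoint adj_ok (r : letter -> letter -> bool) (s : seq letter) : bool :=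
  match s with
  | x :: ((y :: _) as t) => r x y && adj_ok r t
  | _ => true
  end.

(* order 1 < ... < n < 0 < \bar n < ... < \bar 1 *)
Definition rankB (n : nat) (x : letter) : nat :=
  match x with L i => i | Z => n.+1 | Bar i => (n.*2).+2 - i end.

(* order 1 < ... < n-1 < n, \bar n < \bar{n-1} < ... < \bar 1 *)
Definition rankD (n : nat) (x : letter) : nat :=
  match x with L i => i | Z => 0 | Bar i => n.*2 - i end.
Definition precD (n : nat) (x y : letter) : bool :=
  letter_eqb x y || (rankD n x < rankD n y).

Definition columnB (n : nat) (c : column) : bool :=
  (size c > 0) && all (validB n) c &&
  adj_ok (fun x y => (rankB n x < rankB n y) || (letter_eqb x Z && letter_eqb y Z)) c.

Definition columnD (n : nat) (c : column) : bool :=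
  (size c > 0) && all (validD n) c && adj_ok (fun x y => ~~ precD n y x) c.

Definition shape (T : tabloid) : seq nat := map size T.

Definition tabloid_ok (colok : column -> bool) (T : tabloid) : bool :=
  all colok T && sorted geq (shape T).

Definition reading (T : tabloid) : word := flatten (rev T).

Definition TY (Y : seq nat) : tabloid := map (fun k => map L (iota 1 k)) Y.
Definition TYminus (n : nat) (Y : seq nat) : tabloid :=
  map (fun k => if k == n then rcons (map L (iota 1 n.-1)) (Bar n)
                else map L (iota 1 k)) Y.

Definition orthB (n : nat) (T : tabloid) : Prop :=
  tabloid_ok (columnB n) T /\ all (fun k => k <= n) (shape T) /\
  conn (cB n) (reading (TY (shape T))) (reading T).

Inductive dsign := DPlus | DMinus | DZero.
Definition dshape := (seq nat * dsign)%type.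

Definition orthD (n : nat) (T : tabloid) (sh : dshape) : Prop :=
  tabloid_ok (columnD n) T /\ all (fun k => k <= n) (shape T) /\
  sh.1 = shape T /\
  match sh.2 with
  | DZero => n \notin shape T /\ conn (cD n) (reading (TY (shape T))) (reading T)
  | DPlus => n \in shape T /\ conn (cD n) (reading (TY (shape T))) (reading T)
  | DMinus => n \in shape T /\
              conn (cD n) (reading (TYminus n (shape T))) (reading T)
  end.

(* P(w): the (unique, by the paper) orthogonal tableau with w(P(w)) ~ w *)
Definition PB (n : nat) (w : word) : tabloid :=
  epsilon (inhabits [::]) (fun T => orthB n T /\ sim (cB n) (reading T) w).

Definition PD (n : nat) (w : word) : tabloid * dshape :=
  epsilon (inhabits ([::], ([::], DZero)))
          (fun p => orthD n p.1 p.2 /\ sim (cD n) (reading p.1) w).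

Definition QB (n : nat) (w : word) : seq (seq nat) :=
  map (fun k => shape (PB n (take k w))) (iota 1 (size w)).

Definition QD (n : nat) (w : word) : seq dshape :=
  map (fun k => (PD n (take k w)).2) (iota 1 (size w)).

(* Main.v *)
(** A highest weight word is a walk of dominant weights: every prefix is again of highest weight,
    and the next letter is determined by the change of weight.  As connectedness passes to prefixes,
    the component of w is therefore encoded by the highest weights of the components of its
    prefixes, and these are the shapes recorded by Q, provided that every word w has an orthogonal
    tableau P(w).  The latter amounts to two facts: highest weight words of the same weight have
    isomorphic components, and columns are stable under the crystal operators.  Columns are
    characterized by their pairs of adjacent letters, so that their stability is a statement about
    words of length 2.

    Uniqueness of the component of given highest weight is reduced to rank 2: if two arrows i, j with
    the same target always close up to a relation which only depends on string lengths ("diamond"),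
    then induction on the depth shows that relations between lowering operators are the same in all
    components of a given highest weight.  In type D_n the rank 2 cases are commuting operators and
    type A2.  For A2 a terminating rewriting system, whose rules are finite isomorphisms of
    components, transforms each word in the letters of the vector crystal and of its dual into a
    tableau, and tableaux of a given shape have a unique highest weight vertex.  Type B_n is embedded
    in type D_(n+1) as a virtual crystal, where f_i becomes f_i^2 for i < n and f_n becomes
    f_n f_(n+1). *)
Require Import Defs.
From Stdlib Require Import Relation_Operators ClassicalEpsilon.
From HB Require Import structures.
From mathcomp Require Import all_boot zify.

Set Implicit Arguments.
Unset Strict Implicit.
Unset Printing Implicit Defensive.

(** * Crystals of words *)

Lemma letter_eqP : Equality.axiom letter_eqb.
Proof.
by case=> [i||i] [j||j] /=; apply: (iffP idP) => // [/eqP -> //|[->]].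
Qed.

HB.instance Definition _ := hasDecEq.Build letter letter_eqP.

(** All that is assumed of the letters; [fw_stat] and [fw_ew] lift both properties from letters to
    words. *)
Definition regular (C : vcrystal) : Prop :=
  (forall i x y, cf C i x = Some y <-> ce C i y = Some x) /\
  (forall i x y, cf C i x = Some y ->
     phil C i x = (phil C i y).+1 /\ epsl C i y = (epsl C i x).+1).

Section Words.
Variable C : vcrystal.
Implicit Types (u v w : word) (x y : letter) (i : nat).

Lemma epsw_cat i u v :
  epsw C i (u ++ v) = epsw C i u + (epsw C i v - phiw C i u).
Proof. elim: u => [|x u IH] /=; lia. Qed.

Lemma phiw_cat i u v :
  phiw C i (u ++ v) = phiw C i v + (phiw C i u - epsw C i v).
Proof. elim: u => [|x u IH] /=; first lia. rewrite IH epsw_cat; lia. Qed.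

Lemma epsw1 i x : epsw C i [:: x] = epsl C i x.
Proof. by rewrite /= sub0n addn0. Qed.

Lemma phiw1 i x : phiw C i [:: x] = phil C i x.
Proof. by rewrite /= subn0. Qed.

Lemma fw1 i x : fw C i [:: x] = omap (fun y => [:: y]) (cf C i x).
Proof.
rewrite /=; case: ifP => // /negbT; rewrite -leqNgt leqn0 /phil /=.
by case: (cf C i x).
Qed.

Lemma phil0 i x : (phil C i x == 0) = (cf C i x == None).
Proof. by rewrite /phil /=; case: (cf C i x). Qed.

Lemma epsl0 i x : (epsl C i x == 0) = (ce C i x == None).
Proof. by rewrite /epsl /=; case: (ce C i x). Qed.

Lemma fw_none i w : (fw C i w == None) = (phiw C i w == 0).
Proof.
elim: w => [|x w IH] //=; rewrite addn_eq0 subn_eq0; have := phil0 i x.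
case: (ltnP (epsw C i w)) => h /=; first by rewrite andbF; case: (cf C i x) => // /eqP h0; rewrite h0 in h.
by rewrite andbT -IH; case: (fw C i w).
Qed.

Lemma ew_none i w : (ew C i w == None) = (epsw C i w == 0).
Proof.
elim: w => [|x w IH] //=; rewrite addn_eq0 subn_eq0 epsl0.
case: (ltnP (phil C i x)) => h /=; rewrite ?andbF ?andbT.
  have : epsw C i w != 0 by lia.
  by rewrite -IH; case: (ew C i w).
by case: (ce C i x).
Qed.

Lemma fw_some i w : 0 < phiw C i w -> exists v, fw C i w = Some v.
Proof.
by rewrite lt0n -fw_none; case: (fw C i w) => // v _; exists v.
Qed.

Lemma ew_some i w : 0 < epsw C i w -> exists v, ew C i w = Some v.
Proof.
by rewrite lt0n -ew_none; case: (ew C i w) => // v _; exists v.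
Qed.

Lemma fw_phi_gt0 i w v : fw C i w = Some v -> 0 < phiw C i w.
Proof. by move=> E; rewrite lt0n -fw_none E. Qed.

Lemma ew_eps_gt0 i w v : ew C i w = Some v -> 0 < epsw C i w.
Proof. by move=> E; rewrite lt0n -ew_none E. Qed.

(** Associativity of the tensor product: the rule, which the definition applies only behind the
    first letter, holds for a cut at any position. Together with [epsw_cat] and [phiw_cat], it shows
    that a factor matters to the rest of the word only through its string lengths. *)
Lemma fw_cat i u v :
  fw C i (u ++ v) = if epsw C i v < phiw C i u then omap (cat^~ v) (fw C i u)
                    else omap (cat u) (fw C i v).
Proof.
elim: u => [|x u IH] /=; first by case: (fw C i v).
rewrite IH epsw_cat; case: (ltnP (epsw C i u) (phil C i x)) => h.
  case: ifP => h1; case: ifP => h2; try lia; first by case: (cf C i x).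
  case: ifP => h3; first lia.
  by case: (fw C i v).
case: ifP => h1; first lia.
case: ifP => h2; case: ifP => h3; try lia; first by case: (fw C i u).
by case: (fw C i v).
Qed.

Lemma ew_cat i u v :
  ew C i (u ++ v) = if phiw C i u < epsw C i v then omap (cat u) (ew C i v)
                    else omap (cat^~ v) (ew C i u).
Proof.
elim: u => [|x u IH] /=.
  by case: ifP; rewrite ?lt0n -?ew_none; case: (ew C i v).
rewrite IH epsw_cat; case: (ltnP (phil C i x) (epsw C i u)) => h.
  case: ifP => h1; last lia.
  case: ifP => h2; case: ifP => h3; try lia; first by case: (ew C i v).
  by case: (ew C i u).
case: ifP => h1; case: ifP => h2; try lia; last by case: (ce C i x).
by case: ifP => h3; [case: (ew C i v) | lia].
Qed.

Lemma fw_size i u v : fw C i u = Some v -> size v = size u.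
Proof.
elim: u v => [|x u IH] v //=; case: ifP => h.
  by case: (cf C i x) => [y|] //= [<-].
by case E: (fw C i u) => [u'|] //= [<-] /=; rewrite (IH _ E).
Qed.

Definition idx : pred nat := fun i => 1 <= i <= cn C.

Lemma conn_refl u : conn C u u. Proof. exact: rst_refl. Qed.
Lemma conn_sym u v : conn C u v -> conn C v u. Proof. exact: rst_sym. Qed.
Lemma conn_trans v u w : conn C u v -> conn C v w -> conn C u w.
Proof. exact: rst_trans. Qed.
Lemma conn_fw i u v : idx i -> fw C i u = Some v -> conn C u v.
Proof. by move=> hi E; apply: rst_step; exists i. Qed.

Lemma conn_ind_inv (P : word -> Prop) u v :
  (forall i a b, idx i -> fw C i a = Some b -> P a <-> P b) ->
  conn C u v -> P u <-> P v.
Proof. by move=> H; elim=> [a b [i [hi E]]||a b _ []|a b c _ [? ?] _ []]; firstorder. Qed.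

Lemma conn_size u v : conn C u v -> size u = size v.
Proof.
move=> h; have [H _] : size u = size u <-> size u = size v; last exact: H.
by apply: (conn_ind_inv (P := fun w => size u = size w)) h => i a b _ /fw_size ->.
Qed.

Hypothesis Creg : regular C.

Lemma fw_stat i u v : fw C i u = Some v ->
  epsw C i v = (epsw C i u).+1 /\ phiw C i u = (phiw C i v).+1.
Proof.
elim: u v => [|x u IH] v //=; case: ifP => h.
  case E: (cf C i x) => [y|] //= [<-] /=; have [_ /(_ _ _ _ E)] := Creg; lia.
case E: (fw C i u) => [u'|] //= [<-] /=; have := IH _ E; lia.
Qed.

Lemma fw_ew i u v : fw C i u = Some v <-> ew C i v = Some u.
Proof.
have [H1 H2] := Creg; split.
  elim: u v => [|x u IH] v //=; case: ifP => h.
    case E: (cf C i x) => [y|] //= [<-] /=; have := H2 _ _ _ E.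
    by case: ifP => h1 h2; first lia; have /H1 -> := E.
  case E: (fw C i u) => [u'|] //= [<-] /=; have := fw_stat E.
  by rewrite (IH _ E); case: ifP => // h1 h2; lia.
elim: v u => [|x v IH] u //=; case: ifP => h.
  case E: (ew C i v) => [u'|] //= [<-] /=.
  by rewrite (IH _ E); have := fw_stat (IH _ E); case: ifP => // h1 h2; lia.
case E: (ce C i x) => [y|] //= [<-] /=.
by move/H1: E => E; have := H2 _ _ _ E; rewrite E; case: ifP => //; lia.
Qed.

Lemma fw_inj i u u' v : fw C i u = Some v -> fw C i u' = Some v -> u = u'.
Proof. by move=> /fw_ew E /fw_ew; rewrite E => -[]. Qed.

(** An operator acts on exactly one side of a fixed cut position, so each side moves within its own
    component. *)
Lemma conn_cat u v w : conn C (u ++ v) w ->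
  conn C u (take (size u) w) /\ conn C v (drop (size u) w).
Proof.
set k := size u => H.
have [|H' _] := conn_ind_inv
  (P := fun a => conn C u (take k a) /\ conn C v (drop k a)) _ H; last first.
  by apply: H'; rewrite take_size_cat ?drop_size_cat //; split; exact: conn_refl.
move=> i a b hi; rewrite -{1}(cat_take_drop k a) fw_cat.
have szk (c d : word) : size c = size (take k a) -> k <= size a \/ d = [::] ->
    take k (c ++ d) = c /\ drop k (c ++ d) = d.
  rewrite size_take_min => sc [ka|->].
    by rewrite take_size_cat ?drop_size_cat //; lia.
  by rewrite cats0 take_oversize ?drop_oversize //; lia.
(* The invariant is stated for arbitrary words, so the cut may lie beyond the end of [a]; the right
   side is then empty and no operator acts on it. *)
have ha : k <= size a \/ drop k a = [::].
  by case: (leqP k (size a)) => h; [left|right; apply: drop_oversize; lia].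
case: ifP => _.
  case E: (fw C i _) => [c|] //= [<-].
  have [-> ->] := szk c (drop k a) (fw_size E) ha.
  have ht := conn_fw hi E; split=> -[h1 h2]; split=> //.
    exact: conn_trans h1 ht.
  exact: conn_trans h1 (conn_sym ht).
case E: (fw C i _) => [c|] //= [<-].
have [|-> ->] := szk (take k a) c erefl.
  by case: ha => [|h]; [left|move: E; rewrite h].
have ht := conn_fw hi E; split=> -[h1 h2]; split=> //.
  exact: conn_trans h2 ht.
exact: conn_trans h2 (conn_sym ht).
Qed.

Lemma conn_take k u v : conn C u v -> conn C (take k u) (take k v).
Proof.
move=> h; case: (leqP k (size u)) => hk.
  have := h; rewrite -{1}(cat_take_drop k u) => /conn_cat [].
  by rewrite size_takel.
by rewrite !take_oversize // -?(conn_size h) ltnW.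
Qed.

Lemma fseq_cat s t u : fseq C (s ++ t) u = obind (fseq C s) (fseq C t u).
Proof.
rewrite /fseq; elim: s => [|i s IH] /=; first by case: (foldr _ _ t).
by rewrite IH; case: (foldr _ _ t).
Qed.

Lemma fseq_cons i s u : fseq C (i :: s) u = obind (fw C i) (fseq C s u).
Proof. by []. Qed.

Lemma conn_fseq s u v : all idx s -> fseq C s u = Some v -> conn C u v.
Proof.
elim: s v => [|i s IH] v; first by move=> _ [->]; exact: conn_refl.
move=> /= /andP [hi hs]; case E: (fseq C s u) => [w|] //= Ew.
exact: conn_trans (IH _ hs E) (conn_fw hi Ew).
Qed.

Lemma fseq_nseq_eps i m u v : fseq C (nseq m i) u = Some v ->
  epsw C i v = epsw C i u + m.
Proof.
elim: m v => [|m IH] v; first by case=> ->; rewrite addn0.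
rewrite fseq_cons; case E: (fseq C _ u) => [w|] //= /fw_stat [-> _].
by rewrite (IH _ E) addnS.
Qed.

Lemma emax i u : exists v, fseq C (nseq (epsw C i u) i) v = Some u.
Proof.
move: {2}(epsw C i u) (erefl (epsw C i u)) => m; elim: m u => [|m IH] u E.
  by exists u; rewrite E.
have [|u' /fw_ew Eu] := @ew_some i u; first by rewrite E.
have [h _] := fw_stat Eu; have [v Ev] := IH u' ltac:(lia).
exists v; rewrite E -[nseq _ _]/(i :: nseq m i) fseq_cons.
have -> : m = epsw C i u' by lia.
by rewrite Ev.
Qed.

Lemma fseq_count_phi i m u v : fseq C (nseq m i) u = Some v ->
  phiw C i u = phiw C i v + m.
Proof.
elim: m v => [|m IH] v; first by case=> ->; rewrite addn0.
rewrite fseq_cons; case E: (fseq C _ u) => [w|] //= /fw_stat [_ h].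
by rewrite (IH _ E) h addSnnS.
Qed.

End Words.

(** * Isomorphisms of components *)

Section Iso.
Variables (C : vcrystal) (J : pred nat).
Implicit Types (u v w : word) (R : word -> word -> Prop).

(** A partial bijection closed under the operators with colours in [J]. Being a relation, it can be
    given by a finite list, by composition or by pulling back, and its domain need not be
    connected. *)
Record crystal_bij R : Prop := CrystalBij {
  cb_str : forall u u' i, R u u' -> J i ->
    epsw C i u = epsw C i u' /\ phiw C i u = phiw C i u';
  cb_fw : forall u u' i v, R u u' -> J i -> fw C i u = Some v ->
    exists2 v', fw C i u' = Some v' & R v v';
  cb_ew : forall u u' i v, R u u' -> J i -> ew C i u = Some v ->
    exists2 v', ew C i u' = Some v' & R v v';
  cb_fun : forall u v v', R u v -> R u v' -> v = v';
  cb_inj : forall u v v', R v u -> R v' u -> v = v' }.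

Definition iso u u' := exists2 R, crystal_bij R & R u u'.

Lemma iso_refl u : iso u u.
Proof.
exists eq => //; split; try by move=> *; subst.
- by move=> u' u'' i v <- _ E; exists v.
- by move=> u' u'' i v <- _ E; exists v.
Qed.

Lemma iso_trans v u w : iso u v -> iso v w -> iso u w.
Proof.
case=> R hR Ruv [S hS Svw]; exists (fun a b => exists2 c, R a c & S c b); last by exists v.
split.
- move=> a b i [c Rac Scb] Ji.
  by have [-> ->] := cb_str hR Rac Ji; exact: cb_str hS _ _ _ Scb Ji.
- move=> a b i a' [c Rac Scb] Ji E.
  have [c' Ec Rc] := cb_fw hR Rac Ji E; have [b' Eb Sb] := cb_fw hS Scb Ji Ec.
  by exists b' => //; exists c'.
- move=> a b i a' [c Rac Scb] Ji E.
  have [c' Ec Rc] := cb_ew hR Rac Ji E; have [b' Eb Sb] := cb_ew hS Scb Ji Ec.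
  by exists b' => //; exists c'.
- move=> a b b' [c Rac Scb] [c' Rac' Scb'].
  by rewrite (cb_fun hR Rac' Rac) in Scb'; exact: cb_fun hS _ _ _ Scb Scb'.
- move=> b a a' [c Rac Scb] [c' Rac' Scb'].
  by rewrite (cb_inj hS Scb' Scb) in Rac'; exact: cb_inj hR _ _ _ Rac Rac'.
Qed.

Lemma crystal_bij_sym R : crystal_bij R -> crystal_bij (fun a b => R b a).
Proof.
move=> hR; split.
- by move=> u u' i Ruu Ji; have [-> ->] := cb_str hR Ruu Ji.
- move=> u u' i v Ruu Ji E; have [_ Ep] := cb_str hR Ruu Ji.
  have [|v' E'] := @fw_some C i u'; first by rewrite Ep (fw_phi_gt0 E).
  exists v' => //; have [v'' E'' Rv] := cb_fw hR Ruu Ji E'.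
  by move: E''; rewrite E => -[->].
- move=> u u' i v Ruu Ji E; have [Ep _] := cb_str hR Ruu Ji.
  have [|v' E'] := @ew_some C i u'; first by rewrite Ep (ew_eps_gt0 E).
  exists v' => //; have [v'' E'' Rv] := cb_ew hR Ruu Ji E'.
  by move: E''; rewrite E => -[->].
- by move=> u v v'; exact: (cb_inj hR).
- by move=> u v v'; exact: (cb_fun hR).
Qed.

Lemma iso_sym u v : iso u v -> iso v u.
Proof. by case=> R /crystal_bij_sym hR Ruv; exists (fun a b => R b a). Qed.

Hypothesis Creg : regular C.

(** The operators see the middle factor only through its string lengths, which an isomorphism
    preserves. This permits rewriting inside a word. *)
Lemma iso_cat l r u v : iso u v -> iso (l ++ u ++ r) (l ++ v ++ r).
Proof.
case=> R hR Ruv.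
(* The sizes of the outer factors are prescribed so that a word decomposes in one way only, which
   makes [S] functional and injective. *)
pose S a b := exists x c d z, [/\ size x = size l, size z = size r, R c d,
  a = x ++ c ++ z & b = x ++ d ++ z].
exists S; last by exists l, u, v, r.
have split_inj (x c z x' c' z' : word) : size x = size x' -> size z = size z' ->
    x ++ c ++ z = x' ++ c' ++ z' -> [/\ x = x', c = c' & z = z'].
  move=> sx sz E; have [-> E'] : x = x' /\ c ++ z = c' ++ z'.
    by move/eqP: E; rewrite eqseq_cat // => /andP [/eqP -> /eqP ->].
  have sc : size c = size c' by move/(congr1 size): E'; rewrite !size_cat; lia.
  by move/eqP: E'; rewrite eqseq_cat // => /andP [/eqP -> /eqP ->].
split.
- move=> _ _ i [x [c [d [z [sx sz Rcd -> ->]]]]] Ji.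
  by rewrite !epsw_cat !phiw_cat !epsw_cat; have [-> ->] := cb_str hR Rcd Ji.
- move=> _ _ i w [x [c [d [z [sx sz Rcd -> ->]]]]] Ji.
  rewrite !fw_cat !epsw_cat; have [-> ->] := cb_str hR Rcd Ji.
  case: ifP => _.
    case E: (fw C i x) => [x'|] //= [<-].
    by exists (x' ++ d ++ z) => //; exists x', c, d, z; rewrite (fw_size E).
  case: ifP => _.
    case E: (fw C i c) => [c'|] //= [<-]; have [d' -> Rd] := cb_fw hR Rcd Ji E.
    by exists (x ++ d' ++ z) => //; exists x, c', d', z.
  case E: (fw C i z) => [z'|] //= [<-].
  by exists (x ++ d ++ z') => //; exists x, c, d, z'; rewrite (fw_size E).
- move=> _ _ i w [x [c [d [z [sx sz Rcd -> ->]]]]] Ji.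
  have es a a' : ew C i a = Some a' -> size a' = size a.
    by move/(fw_ew Creg)/fw_size.
  rewrite !ew_cat !epsw_cat; have [-> ->] := cb_str hR Rcd Ji.
  case: ifP => _.
    case: ifP => _.
      case E: (ew C i z) => [z'|] //= [<-].
      by exists (x ++ d ++ z') => //; exists x, c, d, z'; rewrite (es _ _ E).
    case E: (ew C i c) => [c'|] //= [<-]; have [d' -> Rd] := cb_ew hR Rcd Ji E.
    by exists (x ++ d' ++ z) => //; exists x, c', d', z.
  case E: (ew C i x) => [x'|] //= [<-].
  by exists (x' ++ d ++ z) => //; exists x', c, d, z; rewrite (es _ _ E).
- move=> a b b' [x [c [d [z [sx sz Rcd -> ->]]]]] [x' [c' [d' [z' [sx' sz' Rcd' E ->]]]]].
  have [|| <- Ec <-] := split_inj _ _ _ _ _ _ _ _ E; [by rewrite sx sx'|by rewrite sz sz'|].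
  by rewrite -Ec in Rcd'; rewrite (cb_fun hR Rcd Rcd').
- move=> b a a' [x [c [d [z [sx sz Rcd -> ->]]]]] [x' [c' [d' [z' [sx' sz' Rcd' -> E]]]]].
  have [|| <- Ed <-] := split_inj _ _ _ _ _ _ _ _ E; [by rewrite sx sx'|by rewrite sz sz'|].
  by rewrite -Ed in Rcd'; rewrite (cb_inj hR Rcd Rcd').
Qed.

Lemma cb_fseq R u u' s v : crystal_bij R -> R u u' -> all J s ->
  fseq C s u = Some v -> exists2 v', fseq C s u' = Some v' & R v v'.
Proof.
move=> hR Ruu; elim: s v => [|i s IH] v /=; first by move=> _ [<-]; exists u'.
case/andP => Ji /IH{}IH; case E: (fseq C s u) => [w|] //= Ew.
have [w' Ew' Rw] := IH _ E; have [v' Ev' Rv] := cb_fw hR Rw Ji Ew.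
by exists v' => //; rewrite Ew'.
Qed.

Lemma cb_eseq R u u' s v : crystal_bij R -> R u u' -> all J s ->
  fseq C s v = Some u -> exists2 v', fseq C s v' = Some u' & R v v'.
Proof.
move=> hR; elim: s u u' => [|i s IH] u u' Ruu /=; first by move=> _ [->]; exists u'.
case/andP => Ji hs; case E: (fseq C s v) => [w|] //= /(fw_ew Creg) Ew.
have [w' Ew' Rw] := cb_ew hR Ruu Ji Ew; have [v' Ev' Rv] := IH _ _ Rw hs E.
by exists v' => //; rewrite Ev' /=; apply/fw_ew.
Qed.

Lemma iso_coherent u u' s t v : iso u u' -> all J s -> all J t ->
  fseq C s u = Some v -> fseq C t u = Some v -> fseq C s u' = fseq C t u'.
Proof.
case=> R hR Ruu hs ht Es Et.
have [a -> Ra] := cb_fseq hR Ruu hs Es; have [b -> Rb] := cb_fseq hR Ruu ht Et.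
by rewrite (cb_fun hR Ra Rb).
Qed.

End Iso.

(* The rank 2 input for the uniqueness of highest weight crystals: two arrows i, j into a vertex
   close up to a cycle through z, and the cycle closes up again at any z' which looks like z. *)
Definition diamond (C : vcrystal) (i j : nat) : Prop :=
  forall x x1 x2, fw C i x1 = Some x -> fw C j x2 = Some x ->
  exists z p q, [/\ all (mem [:: i; j]) (p ++ q), fseq C p z = Some x1, fseq C q z = Some x2 &
    forall z', (forall k, k \in [:: i; j] -> epsw C k z' = epsw C k z /\ phiw C k z' = phiw C k z) ->
      fseq C (i :: p) z' = fseq C (j :: q) z'].

Lemma diamond_sym C i j : diamond C i j -> diamond C j i.
Proof.
move=> H x x1 x2 E1 E2; have [z [p [q [hp Ep Eq Hz]]]] := H _ _ _ E2 E1.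
exists z, q, p; split=> //.
  by move: hp; rewrite !all_cat andbC; congr (_ && _ = true);
    apply: eq_all => k /=; rewrite !inE orbC.
by move=> z' hz; rewrite Hz // => k hk; apply: hz; rewrite !inE orbC in hk *.
Qed.

(** * Uniqueness of the component of a given highest weight *)

Section HighestWeight.
Variable C : vcrystal.
Hypothesis Creg : regular C.
Variable ht : word -> nat.
Hypothesis fw_ht : forall i u v, fw C i u = Some v -> ht v = (ht u).+1.
Let J := idx C.

Definition top w h := highest C h /\ exists2 s, all (idx C) s & fseq C s h = Some w.

Lemma highest_eps h i : highest C h -> J i -> epsw C i h = 0.
Proof. by move=> hh /hh E; apply/eqP; rewrite -ew_none E. Qed.

Lemma eps_highest h : (forall i, J i -> epsw C i h = 0) -> highest C h.
Proof. by move=> H i hi; apply/eqP; rewrite ew_none H. Qed.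

Lemma highest_or w : highest C w \/ exists i u, J i /\ fw C i u = Some w.
Proof.
case: (boolP (all (fun i => epsw C i w == 0) (iota 1 (cn C)))) => [/allP H|/allPn [i]].
  left; apply: eps_highest => i hi; apply/eqP/H; rewrite mem_iota; move: hi; rewrite /J /idx; lia.
rewrite mem_iota -lt0n => hi /ew_some [u /(fw_ew Creg) E].
by right; exists i, u; split=> //; rewrite /J /idx; lia.
Qed.

Lemma top_fw i u w h : J i -> fw C i u = Some w -> top u h -> top w h.
Proof.
move=> Ji E [hh [s hs Es]]; split=> //; exists (i :: s); first by rewrite /= hs andbT.
by rewrite fseq_cons Es.
Qed.

Lemma top_fseq s u w h : all J s -> fseq C s u = Some w -> top u h -> top w h.
Proof.
elim: s w => [|i s IH] w; first by move=> _ [->].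
case/andP=> Ji hs; rewrite fseq_cons; case E: (fseq C s u) => [v|] //= Ev ht0.
exact: top_fw Ji Ev (IH _ hs E ht0).
Qed.

Lemma top_self h : highest C h -> top h h.
Proof. by split=> //; exists [::]. Qed.

Lemma top_exists w : exists h, top w h.
Proof.
move: {2}(ht w) (leqnn (ht w)) => m; elim: m w => [|m IH] w hw.
  case: (highest_or w) => [/top_self|[i [u [_ /fw_ht]]]]; [by exists w|lia].
case: (highest_or w) => [/top_self|[i [u [Ji E]]]]; first by exists w.
have [h H] := IH u ltac:(have := fw_ht E; lia).
by exists h; exact: top_fw Ji E H.
Qed.

Lemma fseq_ht s u v : fseq C s u = Some v -> ht v = ht u + size s.
Proof.
elim: s v => [|i s IH] v; first by case=> ->; rewrite addn0.
rewrite fseq_cons; case E: (fseq C s u) => [w|] //= /fw_ht ->.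
by rewrite (IH _ E) addnS.
Qed.

Lemma highest_nofw h i u : highest C h -> J i -> fw C i u = Some h -> False.
Proof. by move=> hh /hh E /(fw_ew Creg); rewrite E. Qed.

Hypothesis Cdiamond : forall i j, J i -> J j -> i != j -> diamond C i j.

Lemma sub_idx i j s : J i -> J j -> all (mem [:: i; j]) s -> all J s.
Proof. by move=> Ji Jj; apply: sub_all => k; rewrite !inE => /orP [] /eqP ->. Qed.

(* Newman's lemma: the diamonds are the local confluence of the raising operators. *)
Lemma top_unique w h h' : top w h -> top w h' -> h = h'.
Proof.
move: {2}(ht w) (leqnn (ht w)) => m; elim: m w h h' => [|m IH] w h h' hw.
  case=> [hh [[|i s] hs Es]]; last by have := fseq_ht Es => /=; lia.
  case=> [hh' [[|i s'] hs' Es']]; last by have := fseq_ht Es' => /=; lia.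
  by move: Es Es' => [->] [->].
case=> [hh [[|i s] hs Es]].
  move: Es => [Eh]; rewrite {}Eh in hh *.
  case=> [hh' [[|j t] /= ht' Et]]; first by case: Et.
  case: (fseq C t h') Et => //= y Ey; case/andP: ht' => Jj _.
  by case: (highest_nofw hh Jj Ey).
case=> [hh' [[|j t] ht' Et]].
  move: Et => [Eh]; rewrite {}Eh in hh' *.
  move: hs Es => /andP [Ji _]; rewrite fseq_cons; case: (fseq C s h) => //= y Ey.
  by case: (highest_nofw hh' Ji Ey).
case/andP: hs Es => Ji hs; rewrite fseq_cons; case E1: (fseq C s h) => [x1|] //= F1.
case/andP: ht' Et => Jj ht'; rewrite fseq_cons; case E2: (fseq C t h') => [x2|] //= F2.
have T1 : top x1 h by split=> //; exists s.
have T2 : top x2 h' by split=> //; exists t.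
have h1 := fw_ht F1; have h2 := fw_ht F2.
case: (eqVneq i j) => [Eij|nij].
  rewrite -Eij in F2; rewrite (fw_inj Creg F2 F1) in T2.
  by apply: IH T1 T2; lia.
have [z [p [q [hpq Ep Eq _]]]] := Cdiamond Ji Jj nij F1 F2.
move: hpq; rewrite all_cat => /andP [/(sub_idx Ji Jj) hp /(sub_idx Ji Jj) hq].
have [h0 T0] := top_exists z.
have T01 := top_fseq hp Ep T0; have T02 := top_fseq hq Eq T0.
have -> := IH _ _ _ _ T1 T01; last by lia.
by apply: IH T02 T2; lia.
Qed.

(** Additive form, free of truncated subtraction, of the fact that an arrow of colour i changes the
    weight coordinate phi_k - eps_k by an amount which depends only on i and k. *)
Hypothesis fw_weight : forall i k u v u' v', fw C i u = Some v -> fw C i u' = Some v' ->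
  phiw C k u + epsw C k v + phiw C k v' + epsw C k u' =
  phiw C k v + epsw C k u + phiw C k u' + epsw C k v'.

(** At highest weight vertices all eps vanish, so the phi are the coordinates of the weight. The two
    statements below are proved by a simultaneous induction on the depth: [strings_agree d] allows
    the last clause of a diamond to be applied, and [coherent d.+1] allows string lengths to be
    compared one step deeper. *)
Definition same_phi h h' := forall k, J k -> phiw C k h = phiw C k h'.

Definition strings_agree d := forall h1 h2 s u, highest C h1 -> highest C h2 ->
  same_phi h1 h2 -> all J s -> size s <= d -> fseq C s h1 = Some u ->
  exists2 u', fseq C s h2 = Some u' &
    forall k, J k -> epsw C k u = epsw C k u' /\ phiw C k u = phiw C k u'.

Definition coherent d := forall h1 h2 s t u, highest C h1 -> highest C h2 ->
  same_phi h1 h2 -> all J s -> all J t -> size s <= d ->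
  fseq C s h1 = Some u -> fseq C t h1 = Some u -> fseq C s h2 = fseq C t h2.

(** The last arrows of the two paths form a diamond under some [z], and [z] lies below [h1] because
    highest weight vertices are unique. The copy [z'] of [z] below [h2] has the same string lengths,
    so the diamond closes at [z'] too. The two shorter paths are replaced by paths through [z] and
    [z'] by the induction hypothesis. *)
Lemma coherent_step d : strings_agree d -> coherent d -> coherent d.+1.
Proof.
move=> hS hC h1 h2 s t u hh1 hh2 hphi hs ht' sz Es Et.
have szt : size t = size s by have := fseq_ht Es; have := fseq_ht Et; lia.
case: s t szt hs ht' sz Es Et => [|i s] [|j t] //= [szt] /andP [Ji hs] /andP [Jj ht'] sz.
case Es: (fseq C s h1) => [x1|] //= F1; case Et: (fseq C t h1) => [x2|] //= F2.
have hC' s' t' v : all J s' -> all J t' -> size s' <= d ->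
    fseq C s' h1 = Some v -> fseq C t' h1 = Some v -> fseq C s' h2 = fseq C t' h2.
  exact: hC.
case: (eqVneq i j) => [Eij|nij].
  rewrite -Eij in F2 *; rewrite (fw_inj Creg F2 F1) in Et.
  by rewrite (hC' _ _ _ hs ht' _ Es Et).
have [z [p [q [hpq Ep Eq Hz]]]] := Cdiamond Ji Jj nij F1 F2.
move: hpq; rewrite all_cat => /andP [/(sub_idx Ji Jj) hp /(sub_idx Ji Jj) hq].
have [h0 T0] := top_exists z.
have T1 : top x1 h1 by split=> //; exists s.
have Eh := top_unique (top_fseq hp Ep T0) T1; rewrite Eh in T0.
case: T0 => _ [r hr Er].
have szr : size r <= d by have := fseq_ht Es; have := fseq_ht Er; have := fseq_ht Ep; lia.
have [z' Ez' Hz'] := hS _ _ _ _ hh1 hh2 hphi hr szr Er.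
have E1 : fseq C s h2 = fseq C (p ++ r) h2.
  by apply: hC' Es _ => //; rewrite ?all_cat ?hp ?hr // fseq_cat Er.
have E2 : fseq C t h2 = fseq C (q ++ r) h2.
  by apply: hC' Et _ => //; rewrite ?all_cat ?hq ?hr ?szt // fseq_cat Er.
rewrite E1 E2 !fseq_cat Ez' /= -!fseq_cons; apply: Hz => k hk.
have Jk : J k by move: hk; rewrite !inE => /orP [] /eqP ->.
by have [-> ->] := Hz' _ Jk.
Qed.

(** Coherence yields the equality of the eps, by two inequalities; that of the phi then follows
    because the last arrow changes the weight equally on both sides. *)
Lemma strings_agree_step d : strings_agree d -> coherent d.+1 -> strings_agree d.+1.
Proof.
move=> hS hC h1 h2 s u hh1 hh2 hphi hs sz Es.
case: s hs sz Es => [|i s] /=.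
  move=> _ _ [<-]; exists h2 => // k Jk.
  by rewrite !highest_eps // hphi.
case/andP=> Ji hs sz; case Es: (fseq C s h1) => [x|] //= Fx.
have [x' Es' Hx] := hS _ _ _ _ hh1 hh2 hphi hs sz Es.
have [|u' Fx'] := @fw_some C i x'.
  by have [_ <-] := Hx _ Ji; exact: fw_phi_gt0 Fx.
exists u'; first by rewrite Es'.
have His : all J (i :: s) by rewrite /= Ji.
have E1 : fseq C (i :: s) h1 = Some u by rewrite fseq_cons Es.
have E2 : fseq C (i :: s) h2 = Some u' by rewrite fseq_cons Es'.
(* Raising [v] as far as possible along colour k and from there to [g1] gives a second path to [v].
   By coherence its copy below [g2] ends at [v'], which therefore ends a k-string of at least this
   length. *)
have le_eps g1 g2 v v' k : J k -> highest C g1 -> highest C g2 -> same_phi g1 g2 ->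
    fseq C (i :: s) g1 = Some v -> fseq C (i :: s) g2 = Some v' -> epsw C k v <= epsw C k v'.
  move=> Jk hg1 hg2 hg F1 F2; have [y Ey] := emax Creg k v.
  have [h0 T0] := top_exists y.
  have hn : all J (nseq (epsw C k v) k) by rewrite all_nseq Jk orbT.
  have Tv : top v g1 by split=> //; exists (i :: s).
  have Eh := top_unique (top_fseq hn Ey T0) Tv; rewrite Eh in T0; case: T0 => _ [r hr Er].
  have := hC g1 g2 (i :: s) (nseq (epsw C k v) k ++ r) v hg1 hg2 hg His.
  rewrite F2 all_cat hn hr !fseq_cat Er => /(_ isT sz F1 Ey).
  by case: (fseq C r g2) => //= y' /esym /(fseq_nseq_eps Creg) ->; lia.
move=> k Jk; have Ee : epsw C k u = epsw C k u'.
  apply/eqP; rewrite eqn_leq (le_eps _ _ _ _ _ Jk hh1 hh2 hphi E1 E2) /=.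
  by apply: (le_eps _ _ _ _ _ Jk hh2 hh1 _ E2 E1) => m Jm; rewrite hphi.
split=> //; have [e1 e2] := Hx _ Jk; have := fw_weight k Fx Fx'; lia.
Qed.

Lemma agree_all d : strings_agree d /\ coherent d.
Proof.
elim: d => [|d [hS hC]].
  split.
    move=> h1 h2 [|//] u hh1 hh2 hphi _ _ [<-]; exists h2 => // k Jk.
    by rewrite !highest_eps // hphi.
  move=> h1 h2 [|//] t u hh1 hh2 hphi _ ht' _ Es Et.
  have := fseq_ht Es; have := fseq_ht Et => /=.
  by case: t {ht' Et} => //= *; lia.
have hC' := coherent_step hS hC; split=> //; exact: strings_agree_step.
Qed.

Theorem highest_iso h1 h2 : highest C h1 -> highest C h2 -> same_phi h1 h2 -> iso C J h1 h2.
Proof.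
move=> hh1 hh2 hphi.
have hphi' : same_phi h2 h1 by move=> k /hphi.
have hS g1 g2 s u : highest C g1 -> highest C g2 -> same_phi g1 g2 -> all J s ->
    fseq C s g1 = Some u -> exists2 u', fseq C s g2 = Some u' &
    forall k, J k -> epsw C k u = epsw C k u' /\ phiw C k u = phiw C k u'.
  move=> a b c e f; case: (agree_all (size s)) => H _; exact: H a b c e (leqnn _) f.
have hC g1 g2 s t u : highest C g1 -> highest C g2 -> same_phi g1 g2 -> all J s -> all J t ->
    fseq C s g1 = Some u -> fseq C t g1 = Some u -> fseq C s g2 = fseq C t g2.
  move=> a b c e f Es Et; case: (agree_all (size s)) => _ H; exact: H a b c e f (leqnn _) Es Et.
(* Two words correspond when the same path leads to them from [h1] and [h2]; coherence in both
   directions makes this relation functional and injective. *)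
exists (fun u u' => exists s, [/\ all J s, fseq C s h1 = Some u & fseq C s h2 = Some u']);
  last by exists [::].
split.
- move=> u u' i [s [hs E1 E2]] Ji; have [v E2' Hv] := hS _ _ _ _ hh1 hh2 hphi hs E1.
  by move: E2'; rewrite E2 => -[->]; exact: Hv.
- move=> u u' i v [s [hs E1 E2]] Ji E.
  have hs' : all J (i :: s) by rewrite /= Ji.
  have Eis : fseq C (i :: s) h1 = Some v by rewrite fseq_cons E1.
  have [v' E' _] := hS _ _ _ _ hh1 hh2 hphi hs' Eis.
  exists v'; first by move: E'; rewrite fseq_cons E2.
  by exists (i :: s).
- move=> u u' i v [s [hs E1 E2]] Ji /(fw_ew Creg) E.
  (* The raised word has a highest weight vertex above it, which lies above [u] as well and hence is
     [h1]; the path from there to [v] is the one to be copied. *)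
  have [h0 T0] := top_exists v.
  have T1 : top u h1 by split=> //; exists s.
  have Eh := top_unique (top_fw Ji E T0) T1; rewrite Eh in T0; case: T0 => _ [r hr Er].
  have [v' Er' _] := hS _ _ _ _ hh1 hh2 hphi hr Er.
  exists v'; last by exists r.
  apply/(fw_ew Creg); have := hC _ _ s (i :: r) _ hh1 hh2 hphi hs _ E1.
  by rewrite E2 !fseq_cons Er Er' /= hr Ji => /(_ isT E) ->.
- move=> u v v' [s [hs E1 E2]] [t [ht' F1 F2]].
  by have := hC _ _ _ _ _ hh1 hh2 hphi hs ht' E1 F1; rewrite E2 F2 => -[].
- move=> u v v' [s [hs E1 E2]] [t [ht' F1 F2]].
  by have := hC _ _ _ _ _ hh2 hh1 hphi' hs ht' E2 F2; rewrite E1 F1 => -[].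
Qed.

End HighestWeight.

(** * Type A2 *)

(** By the tensor rule, a letter changed in a word is also the letter changed in each adjacent pair
    which contains it, taken as a word of length 2. Hence stability of [r] on pairs suffices. *)
Lemma fw_sorted C i (P : pred letter) (r : rel letter) w w' :
  (forall x y x' y', P x -> P y -> fw C i [:: x; y] = Some [:: x'; y'] -> r x y = r x' y') ->
  all P w -> fw C i w = Some w' -> sorted r w = sorted r w'.
Proof.
move=> H; elim: w w' => [|x w IH] w' //= /andP [Px Pw]; case: ifP => hx.
  case E: (cf C i x) => [x'|] //= [<-]; case: w Pw hx {IH} => [|y w] //= /andP [Py _] hx.
  rewrite (H x y x' y) //= sub0n addn0 E ifT //; lia.
case E: (fw C i w) => [v|] //= [<-].
case: w Pw IH hx E => [|y w] //= /andP [Py Pw] IH hx E.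
have /= := IH v; rewrite Py Pw => /(_ isT E).
case: ifP E => hy; last by case: (fw C i w) => //= z [<-] /= ->.
case E: (cf C i y) => [y'|] //= [<-] /= ->; rewrite (H x y x y') //=.
rewrite sub0n addn0 ifF ?ifT ?E //; first by lia.
by move: hx; rewrite (_ : epsw C i w - phil C i y = 0) ?addn0 //; lia.
Qed.

(* Letters L 0 -1-> L 1 -2-> L 2 form the vector crystal of type A2, Bar 0 -2-> Bar 1 -1-> Bar 2
   its dual, and all other letters are isolated. *)
Definition fA2 (i : nat) (x : letter) : option letter :=
  match i, x with
  | 1, L 0 => Some (L 1) | 1, Bar 1 => Some (Bar 2)
  | 2, L 1 => Some (L 2) | 2, Bar 0 => Some (Bar 1)
  | _, _ => None
  end.
Definition eA2 (i : nat) (x : letter) : option letter :=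
  match i, x with
  | 1, L 1 => Some (L 0) | 1, Bar 2 => Some (Bar 1)
  | 2, L 2 => Some (L 1) | 2, Bar 1 => Some (Bar 0)
  | _, _ => None
  end.
Definition cA2 : vcrystal := VCrystal 2 fA2 eA2.

Lemma regular_A2 : regular cA2.
Proof.
split=> [i x y|i x y] /=.
  by case: i => [|[|[|i]]]; case: x => [[|[|[|m]]]||[|[|[|m]]]];
    case: y => [[|[|[|k]]]||[|[|[|k]]]].
by case: i => [|[|[|i]]]; case: x => [[|[|[|m]]]||[|[|[|m]]]];
    case: y => [[|[|[|k]]]||[|[|[|k]]]].
Qed.

Section A2.
Let J := idx cA2.

Lemma idxA2 (P : nat -> Prop) : P 1 -> P 2 -> forall i, J i -> P i.
Proof. by move=> ? ? [|[|[|]]]. Qed.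

Fixpoint paths2 (d : nat) : seq (seq nat) :=
  if d is d'.+1 then [::] :: flatten [seq [:: 1 :: s; 2 :: s] | s <- paths2 d'] else [:: [::]].

(* Paths of length 4 exhaust the components below: the largest one is the adjoint crystal. *)
Definition orbit2 (u u' : word) : seq (word * word) :=
  pmap (fun s => if (fseq cA2 s u, fseq cA2 s u') is (Some v, Some v') then Some (v, v') else None)
       (paths2 4).

Definition opt_in (R : seq (word * word)) (o o' : option word) : bool :=
  match o, o' with Some v, Some v' => (v, v') \in R | None, None => true | _, _ => false end.

Definition bij_check (R : seq (word * word)) : bool :=
  all (fun p => all (fun i =>
    [&& epsw cA2 i p.1 == epsw cA2 i p.2, phiw cA2 i p.1 == phiw cA2 i p.2,
        opt_in R (fw cA2 i p.1) (fw cA2 i p.2) & opt_in R (ew cA2 i p.1) (ew cA2 i p.2)])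
    [:: 1; 2]) R &&
  all (fun p => all (fun q => (p.1 == q.1) == (p.2 == q.2)) R) R.

Lemma bij_checkP R : bij_check R -> crystal_bij cA2 J (fun u v => (u, v) \in R).
Proof.
case/andP => /allP H1 /allP H2.
have H u u' i : (u, u') \in R -> J i -> [/\ epsw cA2 i u = epsw cA2 i u',
    phiw cA2 i u = phiw cA2 i u', opt_in R (fw cA2 i u) (fw cA2 i u') &
    opt_in R (ew cA2 i u) (ew cA2 i u')].
  move=> /H1 /= /andP [A1 /andP [A2 _]]; move: i.
  by apply: idxA2; [case/and4P: A1 => /eqP ? /eqP ? ? ?|case/and4P: A2 => /eqP ? /eqP ? ? ?].
split.
- by move=> u u' i /H h /h [].
- move=> u u' i v /H h /h [_ _ + _] E; rewrite E /=.
  by case: (fw cA2 i u') => // v' ?; exists v'.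
- move=> u u' i v /H h /h [_ _ _ +] E; rewrite E /=.
  by case: (ew cA2 i u') => // v' ?; exists v'.
- by move=> u v v' /H2 /allP h /h /=; rewrite eqxx => /eqP/esym/eqP.
- by move=> u v v' /H2 /allP h /h /=; rewrite eqxx => /eqP/eqP.
Qed.

(** In terms of the vector crystal V and its dual: the exterior squares of V and of the dual are
    replaced by a letter, the trivial components of the two mixed products by the empty word, and
    the adjoint component with the dual letter first by the one with the dual letter last. *)
Definition rules : seq (seq (word * word)) :=
  [:: orbit2 [:: L 0; L 1] [:: Bar 0]; orbit2 [:: Bar 0; Bar 1] [:: L 0];
      orbit2 [:: L 0; Bar 2] [::]; orbit2 [:: Bar 0; L 2] [::];
      orbit2 [:: Bar 0; L 0] [:: L 0; Bar 0]].

Lemma rules_ok : all bij_check rules.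
Proof. by vm_compute. Qed.

(** The components of highest weight 2 omega_1, omega_1 + omega_2 and 2 omega_2. Words with all
    adjacent pairs in these play the role of tableaux, a dual letter standing for a column of height
    two. *)
Definition good_pairs : seq (word * word) :=
  orbit2 [:: L 0; L 0] [:: L 0; L 0] ++ orbit2 [:: L 0; Bar 0] [:: L 0; Bar 0] ++
  orbit2 [:: Bar 0; Bar 0] [:: Bar 0; Bar 0].

Definition good : rel letter := fun x y => ([:: x; y], [:: x; y]) \in good_pairs.

Definition letters2 := [:: L 0; L 1; L 2; Bar 0; Bar 1; Bar 2].
Definition star (x : letter) : bool := if x is Bar _ then true else false.

(* Counts the pairs (dual letter, later letter): it decreases when a dual letter moves right. *)
Fixpoint invs (w : word) : nat := if w is x :: r then star x * size r + invs r else 0.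

Lemma invs_cat u v : invs (u ++ v) = invs u + count star u * size v + invs v.
Proof. elim: u => [|x u IH] //=; rewrite IH size_cat; nia. Qed.

(** Exhausts the 36 pairs: a pair that is not good is either shortened or exchanged. An exchange
    keeps the number of dual letters, so that [invs] also decreases in a longer word containing the
    pair. *)
Lemma pair_rule : all (fun x => all (fun y => good x y || has (fun R => has (fun p =>
    (p.1 == [:: x; y]) && ((size p.2 < 2) || [&& size p.2 == 2, count star p.2 == count star p.1 &
     invs p.2 < invs p.1])) R) rules) letters2) letters2.
Proof. by vm_compute. Qed.

Lemma bad_pair x y : x \in letters2 -> y \in letters2 -> ~~ good x y ->
  exists2 v, iso cA2 J [:: x; y] v &
   (size v < 2) || [&& size v == 2, count star v == count star [:: x; y] & invs v < invs [:: x; y]].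
Proof.
move=> hx hy; have /allP/(_ _ hx)/allP/(_ _ hy) := pair_rule.
case/orP => [->//|/hasP [R hR /hasP [[u v] hp /= /andP [/eqP E h]]]] _.
rewrite {}E in hp h; exists v => //; exists (fun u v => (u, v) \in R) => //.
by apply: bij_checkP; have /allP := rules_ok; apply.
Qed.

Lemma sorted_split (r : rel letter) w : ~~ sorted r w ->
  exists u x y v, w = u ++ [:: x; y] ++ v /\ ~~ r x y.
Proof.
elim: w => [|x [|y w] IH] //=; rewrite negb_and.
case: (boolP (r x y)) => [_|h _] /=; last by exists [::], x, y, w.
by move/IH => [u [a [b [v [-> h]]]]]; exists (x :: u), a, b, v.
Qed.

Lemma isolated x : x \notin letters2 -> iso cA2 J [:: x] [::].
Proof.
move=> hx; exists (fun u v => u = [:: x] /\ v = [::]) => //.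
have H i : J i -> epsw cA2 i [:: x] = 0 /\ phiw cA2 i [:: x] = 0.
  by move: i; apply: idxA2; case: x hx => [[|[|[|m]]]||[|[|[|m]]]].
split.
- by move=> u u' i [-> ->] /H [-> ->].
- by move=> u u' i v [-> ->] /H [_ /eqP]; rewrite -fw_none => /eqP ->.
- by move=> u u' i v [-> ->] /H [/eqP + _]; rewrite -ew_none => /eqP ->.
- by move=> u v v' [_ ->] [_ ->].
- by move=> u v v' [-> _] [-> _].
Qed.

(** One rewriting step: an isolated letter is deleted or a bad pair is replaced. The pair of [size]
    and [invs] decreases lexicographically, which terminates the rewriting in [tableau_exists]. *)
Lemma tableau_step w : all (mem letters2) w && sorted good w \/
  exists2 v, iso cA2 J w v & size v < size w \/ size v = size w /\ invs v < invs w.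
Proof.
case: (boolP (all (mem letters2) w)) => [hl|/allPn [x /path.splitPr [u v] /= hx]] /=; last first.
  right; exists (u ++ v); last by left; rewrite !size_cat /= addnS.
  exact: (@iso_cat _ _ regular_A2 u v [:: x] [::]) (isolated hx).
case: (boolP (sorted good w)) => [|/sorted_split [u [x [y [v [E /bad_pair H]]]]]]; first by left.
right; move: hl; rewrite E !all_cat /= => /andP [_ /andP [/andP [hx /andP [hy _]] _]].
have [z hz sz] := H hx hy; exists (u ++ z ++ v); first exact: (@iso_cat _ _ regular_A2 u v [:: x; y] z).
case/orP: sz => [h|/and3P [/eqP sz /eqP cz hi]]; first by left; rewrite !size_cat /=; lia.
right; rewrite !size_cat sz /=; split=> //.
by rewrite !invs_cat !size_cat sz cz /= in hi *; nia.
Qed.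

Lemma tableau_exists w : exists2 t, iso cA2 J w t & all (mem letters2) t && sorted good t.
Proof.
move: {2}(size w) (leqnn (size w)) => m; elim: m w => [|m IHm] w hw.
  by exists [::]; first by case: w hw => // _; exact: iso_refl.
move: {2}(invs w) (leqnn (invs w)) => k; elim: k w hw => [|k IHk] w hw hk.
  case: (tableau_step w) => [h|[v hv [sv|[_]]]]; [by exists w; first exact: iso_refl| |by lia].
  by have [|t ht h] := IHm v; [rewrite -ltnS; exact: leq_trans sv hw|exists t => //; exact: iso_trans hv ht].
case: (tableau_step w) => [h|[v hv [sv|[sv iv]]]]; first by exists w; first exact: iso_refl.
  by have [|t ht h] := IHm v; [rewrite -ltnS; exact: leq_trans sv hw|exists t => //; exact: iso_trans hv ht].
by have [||t ht h] := IHk v; [by rewrite sv|rewrite -ltnS; exact: leq_trans iv hk|exists t => //; exact: iso_trans hv ht].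
Qed.

Lemma good_letters x y : good x y -> (x \in letters2) && (y \in letters2).
Proof.
have : all (fun p => all (mem letters2) p.1) good_pairs by vm_compute.
by move=> /allP H /H /=; rewrite andbT.
Qed.

Lemma good_fw i x y x' y' : J i ->
  fw cA2 i [:: x; y] = Some [:: x'; y'] -> good x y = good x' y'.
Proof.
have nth z : z \notin letters2 -> forall i z', J i ->
   (fA2 i z = Some z' -> False) /\ (fA2 i z' = Some z -> False).
  move=> hz {}i z' Ji; move: i Ji; apply: idxA2; split; move: hz;
  by case: z => [[|[|[|m]]]||[|[|[|m]]]]; case: z' => [[|[|[|m']]]||[|[|[|m']]]].
have H : all (fun i => all (fun x => all (fun y =>
    if fw cA2 i [:: x; y] is Some [:: x'; y'] then good x y == good x' y' else true)
    letters2) letters2) [:: 1; 2] by vm_compute.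
move=> Ji E; case: (boolP ((x \in letters2) && (y \in letters2))) => [/andP [hx hy]|hxy].
  have hi : i \in [:: 1; 2] by move: i Ji {E}; apply: idxA2.
  by have /allP/(_ _ hi)/allP/(_ _ hx)/allP/(_ _ hy) := H; rewrite E => /eqP.
have /negbTE -> : ~~ good x y by apply: contra hxy; exact: good_letters.
apply/esym/negbTE; apply: contra hxy => /good_letters.
move: E => /=; case: ifP => _.
  case E: (fA2 i x) => [z|] //= [<- <-] /andP [hz ->]; rewrite andbT.
  by apply/negP => /negP /nth /(_ _ z Ji) [] /(_ E).
case: ifP => // _; case E: (fA2 i y) => [z|] //= [<- <-] /andP [-> hz] /=.
by apply/negP => /negP /nth /(_ _ z Ji) [] /(_ E).
Qed.

Definition tableau t := all (mem letters2) t && sorted good t.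

Lemma tableau_closed_ew i t t' : J i -> tableau t -> ew cA2 i t = Some t' -> tableau t'.
Proof.
move=> Ji /andP [hl hs] /(fw_ew regular_A2) E; apply/andP; split; last first.
  rewrite (fw_sorted (P := xpredT) _ _ E) //; last exact: all_predT.
  by move=> x y x' y' _ _; exact: good_fw.
have hx x z : fA2 i x = Some z -> mem letters2 x.
  by move: i Ji {E}; apply: idxA2; case: x => [[|[|[|m]]]||[|[|[|m]]]].
elim: t' t E hl {hs} => [|x t' IH] t //=; case: ifP => _.
  case Ex: (fA2 i x) => [z|] //= [<-] /= /andP [_ ->]; rewrite andbT.
  exact: hx Ex.
by case Et: (fw cA2 i t') => [z|] //= [<-] /= /andP [-> /(IH _ Et) ->].
Qed.

Definition hw_tableau P Q : word := nseq P (L 0) ++ nseq Q (Bar 0).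

Lemma hw_tableau_str P Q : [/\ epsw cA2 1 (hw_tableau P Q) = 0, epsw cA2 2 (hw_tableau P Q) = 0,
  phiw cA2 1 (hw_tableau P Q) = P & phiw cA2 2 (hw_tableau P Q) = Q].
Proof.
have HL k : [/\ epsw cA2 1 (nseq k (L 0)) = 0, epsw cA2 2 (nseq k (L 0)) = 0,
  phiw cA2 1 (nseq k (L 0)) = k & phiw cA2 2 (nseq k (L 0)) = 0].
  by elim: k => [|k [/= -> -> -> ->]] //=; split=> //; rewrite /phil /=; lia.
have HB k : [/\ epsw cA2 1 (nseq k (Bar 0)) = 0, epsw cA2 2 (nseq k (Bar 0)) = 0,
  phiw cA2 1 (nseq k (Bar 0)) = 0 & phiw cA2 2 (nseq k (Bar 0)) = k].
  by elim: k => [|k [/= -> -> -> ->]] //=; split=> //; rewrite /phil /=; lia.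
rewrite /hw_tableau !epsw_cat !phiw_cat; have [-> -> -> ->] := HL P; have [-> -> -> ->] := HB Q.
by split; lia.
Qed.

(** A prefix of a highest weight word has highest weight, so the last letter can be removed. Its eps
    are bounded by the phi of the prefix, and it forms a good pair with the letter before it; only
    [L 0] and [Bar 0] remain. *)
Lemma tableau_highest t : tableau t -> highest cA2 t -> exists P Q, t = hw_tableau P Q.
Proof.
elim/last_ind: t => [|t y IH]; first by exists 0, 0.
rewrite /tableau all_rcons => /andP [/andP [hy hl]]; rewrite -cats1 => hs hh.
have hst : sorted good t by move: hs; rewrite cats1; case: (t) => //= a s; rewrite rcons_path => /andP [].
have he i : J i -> epsw cA2 i t = 0 /\ epsl cA2 i y <= phiw cA2 i t.
  by move=> Ji; have := highest_eps hh Ji; rewrite epsw_cat epsw1; lia.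
have [||P [Q Et]] := IH; [by rewrite /tableau hl|by apply: eps_highest => i /he []|].
have := he 1 isT; have := he 2 isT; rewrite Et; have [_ _ -> ->] := hw_tableau_str P Q => -[_ h2] [_ h1].
have hlast : t != [::] -> good (last (L 0) t) y.
  by move: hs; rewrite cats1; case: (t) => //= a s; rewrite rcons_path => /andP [].
have last_nseq (x : letter) k : last x (nseq k x) = x by elim: k.
(* The three cases of the prefix: empty, ending in [L 0], ending in [Bar 0]. *)
have c1 z : z \in letters2 -> epsl cA2 1 z <= 0 -> epsl cA2 2 z <= 0 -> z = L 0 \/ z = Bar 0.
  by case: z => [[|[|[|m]]]||[|[|[|m]]]] //; by [left|right].
have c2 z : z \in letters2 -> good (L 0) z -> epsl cA2 2 z <= 0 -> z = L 0 \/ z = Bar 0.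
  by case: z => [[|[|[|m]]]||[|[|[|m]]]] //; by [left|right].
have c3 z : z \in letters2 -> good (Bar 0) z -> z = Bar 0.
  by case: z => [[|[|[|m]]]||[|[|[|m]]]].
case: Q Et h2 => [|Q] Et h2.
  have -> : hw_tableau P 0 = nseq P (L 0) by rewrite /hw_tableau cats0.
  have [->|->] : y = L 0 \/ y = Bar 0; last by exists P, 1.
    case: P Et h1 => [|P] Et h1; first exact: c1.
    by apply: c2 => //; move: hlast; rewrite Et /hw_tableau cats0 last_nseq; apply.
  by exists (P + 1), 0; rewrite /hw_tableau cats0 nseqD.
have -> : y = Bar 0.
  apply: c3 => //; move: hlast; rewrite Et /hw_tableau last_cat /= last_nseq; apply.
  by case: (P).
by exists P, (Q.+1 + 1); rewrite /hw_tableau nseqD catA.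
Qed.

Lemma fw_star i u v : fw cA2 i u = Some v -> count star v = count star u.
Proof.
have hx x z : fA2 i x = Some z -> star z = star x.
  by case: i => [|[|[|i]]]; case: x => [[|[|[|m]]]||[|[|[|m]]]] //= [<-].
elim: u v => [|x u IH] v //=; case: ifP => _.
  by case E: (fA2 i x) => [z|] //= [<-] /=; rewrite (hx _ _ E).
by case E: (fw cA2 i u) => [z|] //= [<-] /=; rewrite (IH _ E).
Qed.

(** The size and the number of dual letters are constant along arrows, so the highest weight tableau
    above [t] can be read off [t]. *)
Definition hw_tableau_of t := hw_tableau (size t - count star t) (count star t).

Lemma hw_tableau_ofK P Q : hw_tableau_of (hw_tableau P Q) = hw_tableau P Q.
Proof.
by rewrite /hw_tableau_of /hw_tableau size_cat count_cat !size_nseq !count_nseq /= mul0n mul1n add0n addnK.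
Qed.

Lemma tableau_top t : tableau t -> exists2 s, all J s & fseq cA2 s (hw_tableau_of t) = Some t.
Proof.
pose wt x := match x with L k => k | Bar k => k | Z => 0 end.
pose ht w := sumn (map wt w).
have fht i u v : fw cA2 i u = Some v -> ht v = (ht u).+1.
  have hx x z : fA2 i x = Some z -> wt z = (wt x).+1.
    by case: i => [|[|[|i]]]; case: x => [[|[|[|m]]]||[|[|[|m]]]] //= [<-].
  elim: u v => [|x u IH] v //=; case: ifP => _.
    by case E: (fA2 i x) => [z|] //= [<-]; rewrite /ht /= (hx _ _ E).
  by case E: (fw cA2 i u) => [z|] //= [<-]; rewrite /ht /= -/(ht _) (IH _ E) addnS.
move: {2}(ht t) (leqnn (ht t)) => m; elim: m t => [|m IH] t hm T.
all: case: (highest_or regular_A2 t) => [/(tableau_highest T) [P [Q ->]]|[i [u [Ji E]]]];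
  first by exists [::] => //; rewrite hw_tableau_ofK.
  by have := fht _ _ _ E; lia.
have [|s hs Es] := IH u _ (tableau_closed_ew Ji T (proj1 (fw_ew regular_A2 _ _ _) E)).
  by have := fht _ _ _ E; lia.
exists (i :: s); first by rewrite /= hs andbT.
by rewrite fseq_cons /hw_tableau_of (fw_star E) (fw_size E) Es.
Qed.

Lemma hw_tableau_iso z z' P Q P' Q' : iso cA2 J z (hw_tableau P Q) -> iso cA2 J z' (hw_tableau P' Q') ->
  (forall k, J k -> phiw cA2 k z' = phiw cA2 k z) -> iso cA2 J z z'.
Proof.
move=> h h' H; have [R hR Rz] := h; have [R' hR' Rz'] := h'.
have [_ _ p1 p2] := hw_tableau_str P Q; have [_ _ p1' p2'] := hw_tableau_str P' Q'.
have E k : J k -> phiw cA2 k (hw_tableau P' Q') = phiw cA2 k (hw_tableau P Q).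
  by move=> Jk; have [_ <-] := cb_str hR' Rz' Jk; have [_ <-] := cb_str hR Rz Jk; exact: H.
have eP := E 1 isT; have eQ := E 2 isT; rewrite p1 p1' p2 p2' in eP eQ; subst P' Q'.
exact: iso_trans h (iso_sym h').
Qed.

Lemma A2_top z : highest cA2 z -> exists P Q, iso cA2 J z (hw_tableau P Q).
Proof.
move=> hz; have [t [R hR Rzt] ht] := tableau_exists z.
have [|P [Q Et]] := tableau_highest ht.
  by apply: eps_highest => i Ji; have [<- _] := cb_str hR Rzt Ji; exact: highest_eps hz Ji.
by exists P, Q; rewrite -Et; exists R.
Qed.

(** After passing to a tableau, both raised words are tableaux with the same size and number of dual
    letters, hence lie below the same highest weight tableau; its preimage is [z]. A word [z'] with
    the string lengths of [z] is of highest weight and reduces to the same tableau, so [z] and [z']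
    are isomorphic, and paths which meet below [z] meet below [z']. *)
Lemma diamond_A2 : diamond cA2 1 2.
Proof.
have sJ p : all J p -> all (mem [:: 1; 2]) p.
  by apply: sub_all; apply: idxA2.
move=> x x1 x2 F1 F2; have [t [R hR Rxt] ht] := tableau_exists x.
have rS := crystal_bij_sym hR.
have [t1 Et1 R1] := cb_ew hR Rxt (isT : J 1) (proj1 (fw_ew regular_A2 _ _ _) F1).
have [t2 Et2 R2] := cb_ew hR Rxt (isT : J 2) (proj1 (fw_ew regular_A2 _ _ _) F2).
have [p hp Ep] := tableau_top (tableau_closed_ew (isT : J 1) ht Et1).
have [q hq Eq] := tableau_top (tableau_closed_ew (isT : J 2) ht Et2).
move/(fw_ew regular_A2): Et1 => Et1; move/(fw_ew regular_A2): Et2 => Et2.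
have EK : hw_tableau_of t2 = hw_tableau_of t1.
  rewrite /hw_tableau_of -(fw_star Et1) -(fw_size Et1) -(fw_star Et2) -(fw_size Et2) //.
rewrite {}EK in Eq.
have [z Ez Rz] := cb_eseq regular_A2 rS R1 hp Ep.
have [z' Ez' Rz'] := cb_eseq regular_A2 rS R2 hq Eq.
rewrite (cb_inj hR Rz' Rz) in Ez' => {z' Rz'}.
exists z, p, q; split=> //; first by rewrite all_cat !sJ.
have izK : iso cA2 J z (hw_tableau_of t1) by exists R.
move=> z' Hz'.
have hz' : highest cA2 z'.
  have [e1 e2 _ _] := hw_tableau_str (size t1 - count star t1) (count star t1).
  apply: eps_highest; apply: idxA2.
    by have [-> _] := Hz' 1 isT; have [-> _] := cb_str hR Rz (isT : J 1).
  by have [-> _] := Hz' 2 isT; have [-> _] := cb_str hR Rz (isT : J 2).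
have [P [Q iz'hw_tableau]] := A2_top hz'.
have izz : iso cA2 J z z'.
  by apply: hw_tableau_iso izK iz'hw_tableau _; apply: idxA2; [have [] := Hz' 1 isT|have [] := Hz' 2 isT].
apply: (iso_coherent izz (v := x)); rewrite ?fseq_cons ?Ez ?Ez' //=; by apply/andP.
Qed.

End A2.

(** * Type D *)

Section LetterMorphism.
Variables (C C' : vcrystal) (i i' : nat) (rho : letter -> letter).
Hypothesis rho_f : forall x, cf C' i' (rho x) = omap rho (cf C i x).
Hypothesis rho_e : forall x, ce C' i' (rho x) = omap rho (ce C i x).

Lemma str_len_map (g g' : letter -> option letter) k x :
  (forall y, g' (rho y) = omap rho (g y)) -> str_len g' k (rho x) = str_len g k x.
Proof. by move=> H; elim: k x => [|k IH] x //=; rewrite H; case: (g x) => //= y; rewrite IH. Qed.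

Lemma epsw_phiw_map w :
  epsw C' i' (map rho w) = epsw C i w /\ phiw C' i' (map rho w) = phiw C i w.
Proof.
elim: w => [|x w [/= -> ->]] //=.
by rewrite /phil /epsl (str_len_map _ _ rho_f) (str_len_map _ _ rho_e).
Qed.

Lemma fw_map w : fw C' i' (map rho w) = omap (map rho) (fw C i w).
Proof.
elim: w => [|x w IH] //=; rewrite (proj1 (epsw_phiw_map w)) {1}/phil (str_len_map _ _ rho_f).
rewrite -/(phil C i x) IH rho_f; case: ifP => _; first by case: (cf C i x).
by case: (fw C i w).
Qed.

Lemma ew_map w : ew C' i' (map rho w) = omap (map rho) (ew C i w).
Proof.
elim: w => [|x w IH] //=; rewrite (proj1 (epsw_phiw_map w)) {1}/phil (str_len_map _ _ rho_f).
rewrite -/(phil C i x) IH rho_e; case: ifP => _; last by case: (ce C i x).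
by case: (ew C i w).
Qed.

End LetterMorphism.

(** Raising operators preserve the image of [map rho], so the vertex closing the diamond in [C']
    comes from [C], and injectivity brings the equality of paths back. *)
Lemma diamond_map C C' i j i' j' rho : regular C -> regular C' -> injective rho -> i' != j' ->
  (forall x, cf C' i' (rho x) = omap rho (cf C i x)) ->
  (forall x, ce C' i' (rho x) = omap rho (ce C i x)) ->
  (forall x, cf C' j' (rho x) = omap rho (cf C j x)) ->
  (forall x, ce C' j' (rho x) = omap rho (ce C j x)) ->
  diamond C' i' j' -> diamond C i j.
Proof.
move=> rC rC' rinj nij fi ei fj ej H x x1 x2 F1 F2.
have minj : injective (map rho) := inj_map rinj.
have [||z [p [q [hpq Ep Eq Hz]]]] := H (map rho x) (map rho x1) (map rho x2).
- by rewrite (fw_map fi ei) F1.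
- by rewrite (fw_map fj ej) F2.
pose t k := if k == i' then i else j.
have ti : t i' = i by rewrite /t eqxx.
have tj : t j' = j by rewrite /t eq_sym (negbTE nij).
have mem2 k : k \in [:: i'; j'] -> k = i' \/ k = j' by rewrite !inE => /orP [] /eqP ->; [left|right].
have fk k w : k \in [:: i'; j'] -> fw C' k (map rho w) = omap (map rho) (fw C (t k) w).
  by case/mem2 => ->; rewrite ?ti ?tj; [apply: fw_map|apply: fw_map].
have ek k w : k \in [:: i'; j'] -> ew C' k (map rho w) = omap (map rho) (ew C (t k) w).
  by case/mem2 => ->; rewrite ?ti ?tj; [apply: ew_map|apply: ew_map].
have sk k w : k \in [:: i'; j'] -> epsw C' k (map rho w) = epsw C (t k) w /\
    phiw C' k (map rho w) = phiw C (t k) w.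
  by case/mem2 => ->; rewrite ?ti ?tj; [apply: epsw_phiw_map|apply: epsw_phiw_map].
have fs s w : all (mem [:: i'; j']) s -> fseq C' s (map rho w) = omap (map rho) (fseq C (map t s) w).
  elim: s => [|k s IH] //= /andP [hk hs]; rewrite -/(fseq C' s _) IH //= -/(fseq C _ w).
  by case: (fseq C _ w) => //= v; rewrite fk.
have es s w v : all (mem [:: i'; j']) s -> fseq C' s v = Some (map rho w) ->
    exists2 u, v = map rho u & fseq C (map t s) u = Some w.
  elim: s w => [|k s IH] w; first by move=> _ [->]; exists w.
  move=> /andP [hk hs]; rewrite fseq_cons; case E: (fseq C' s v) => [a|] //= /(fw_ew rC').
  rewrite ek //; case Ew: (ew C (t k) w) => [b|] //= [Ea]; rewrite -Ea in E.
  have [u -> Eu] := IH _ hs E; exists u => //.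
  by rewrite -/(fseq C (map t s) u) Eu /=; apply/(fw_ew rC).
move: hpq; rewrite all_cat => /andP [hp hq].
have [u Ez Eu] := es _ _ _ hp Ep; rewrite Ez in Eq.
have Eu' : fseq C (map t q) u = Some x2.
  move: Eq; rewrite fs //; case: (fseq C _ u) => //= y [] /minj ->; by [].
have sub s : all (mem [:: i'; j']) s -> all (mem [:: i; j]) (map t s).
  rewrite all_map; apply: sub_all => k /mem2 /= [] ->; rewrite ?ti ?tj !inE eqxx ?orbT //.
exists u, (map t p), (map t q); split=> //; first by rewrite all_cat !sub.
move=> z' Hz'.
have omap_inj : injective (omap (map rho)).
  by case=> [a|] [b|] //= [] /minj ->.
have -> : i :: map t p = map t (i' :: p) by rewrite /= ti.
have -> : j :: map t q = map t (j' :: q) by rewrite /= tj.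
apply: omap_inj; rewrite -!fs /= ?hp ?hq ?inE ?eqxx ?orbT //; apply: Hz => k hk.
rewrite Ez; have [-> ->] := sk k z' hk; have [-> ->] := sk k u hk.
by apply: Hz'; case/mem2: hk => ->; rewrite ?ti ?tj !inE eqxx ?orbT.
Qed.

(** * Diamonds of commuting operators *)

Section Commuting.
Variables (C : vcrystal) (i j : nat).
Hypothesis Creg : regular C.

Definition inert (k l : nat) := forall x y, cf C k x = Some y ->
  phil C l y = phil C l x /\ epsl C l y = epsl C l x.

Lemma inert_word k l u v : inert k l -> fw C k u = Some v ->
  epsw C l v = epsw C l u /\ phiw C l v = phiw C l u.
Proof.
move=> H; elim: u v => [|x u IH] v //=; case: ifP => _.
  by case E: (cf C k x) => [y|] //= [<-] /=; have [-> ->] := H _ _ E.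
by case E: (fw C k u) => [u'|] //= [<-] /=; have [-> ->] := IH _ E.
Qed.

Hypotheses (Hij : inert i j) (Hji : inert j i).
Hypothesis Hcomm : forall x, obind (cf C i) (cf C j x) = obind (cf C j) (cf C i x).

(** As each operator leaves the string lengths of the other colour unchanged, it does not change the
    position where the other one acts; at a common position the letters commute. *)
Lemma fw_comm w : obind (fw C i) (fw C j w) = obind (fw C j) (fw C i w).
Proof.
elim: w => [|x w IH] //=.
case: (ltnP (epsw C j w) (phil C j x)) => hj; case: (ltnP (epsw C i w) (phil C i x)) => hi.
- have := Hcomm x; case Ej: (cf C j x) => [y|]; case Ei: (cf C i x) => [z|] //=.
  + by rewrite (proj1 (Hji Ej)) (proj1 (Hij Ei)) hi hj => ->.
  + by rewrite (proj1 (Hji Ej)) hi => ->.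
  + by rewrite (proj1 (Hij Ei)) hj => <-.
- case Ej: (cf C j x) => [y|] /=; last first.
    by case Ei: (fw C i w) => [u|] //=; rewrite (proj1 (inert_word Hij Ei)) hj Ej.
  rewrite (proj1 (Hji Ej)) ltnNge hi /=.
  by case Ei: (fw C i w) => [u|] //=; rewrite (proj1 (inert_word Hij Ei)) hj Ej.
- case Ei: (cf C i x) => [y|] /=; last first.
    by case Ej: (fw C j w) => [u|] //=; rewrite (proj1 (inert_word Hji Ej)) hi Ei.
  rewrite (proj1 (Hij Ei)) (ltnNge (epsw C j w)) hj /=.
  by case Ej: (fw C j w) => [u|] //=; rewrite (proj1 (inert_word Hji Ej)) hi Ei.
- move: IH; case Ej: (fw C j w) => [u|]; case Ei: (fw C i w) => [v|] //=.
  + rewrite (proj1 (inert_word Hji Ej)) (proj1 (inert_word Hij Ei)) !ltnNge hi hj /=.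
    by move=> ->.
  + by rewrite (proj1 (inert_word Hji Ej)) ltnNge hi /= => ->.
  + by rewrite (proj1 (inert_word Hij Ei)) ltnNge hj /= => <-.
Qed.

Lemma diamond_comm : diamond C i j.
Proof.
move=> x x1 x2 F1 F2.
have [|z /(fw_ew Creg) Ez] := @ew_some C j x1.
  by rewrite -(proj1 (inert_word Hij F1)) (proj1 (fw_stat Creg F2)).
have := fw_comm z; rewrite Ez /= F1; case Ei: (fw C i z) => [y|] //= /esym Ey.
rewrite (fw_inj Creg Ey F2) in Ei.
exists z, [:: j], [:: i]; split=> //.
  by rewrite /= !inE !eqxx orbT.
by move=> z' _; rewrite /fseq /=; exact: fw_comm.
Qed.

End Commuting.

(** * Arrows and string lengths in type D *)

Section TypeD.
Variable n : nat.
Hypothesis hn : 2 <= n.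
Let C := cD n.

Inductive arrowD (i : nat) : letter -> letter -> Prop :=
  | ArrL of 0 < i < n : arrowD i (L i) (L i.+1)
  | ArrB of 0 < i < n : arrowD i (Bar i.+1) (Bar i)
  | ArrL' of i = n : arrowD i (L n.-1) (Bar n)
  | ArrB' of i = n : arrowD i (L n) (Bar n.-1).

Lemma fD_arrow i x y : fD n i x = Some y <-> arrowD i x y.
Proof.
split.
  rewrite /fD; case: ifP => [hi|_]; first by
    case: x => [m||m] //; case: eqP => // -> [<-]; [exact: ArrL|exact: ArrB].
  case: eqP => // hi; case: x => [m||m] //; case: eqP => [->|_]; first by case=> <-; exact: ArrL'.
  by case: eqP => // -> [<-]; exact: ArrB'.
rewrite /fD; case=> [h|h|->|->]; rewrite ?h ?eqxx // ltnn andbF //.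
by case: eqP => //; lia.
Qed.

Lemma eD_arrow i x y : eD n i y = Some x <-> arrowD i x y.
Proof.
split.
  rewrite /eD; case: ifP => [hi|_]; first by
    case: y => [m||m] //; case: eqP => // -> [<-]; [exact: ArrL|exact: ArrB].
  case: eqP => // hi; case: y => [m||m] //; case: eqP => [->|_]; first by case=> <-; exact: ArrL'.
  by case: eqP => // -> [<-]; exact: ArrB'.
rewrite /eD; case=> [h|h|->|->]; rewrite ?h ?eqxx // ltnn andbF //.
by case: eqP => //; lia.
Qed.

(** Hence all strings of letters have length at most one, and phi and eps are the indicators [phiD]
    and [epsD]. *)
Lemma arrowD_ends i x y z : arrowD i x y -> arrowD i y z -> False.
Proof.
by case=> h H; inversion H; subst; lia.
Qed.

Definition phiD i x : nat := match x with
  | L m => ((0 < i < n) && (m == i)) || ((i == n) && ((m == n.-1) || (m == n)))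
  | Bar m => (0 < i < n) && (m == i.+1)
  | Z => 0 end.

Definition epsD i x : nat := match x with
  | Bar m => ((0 < i < n) && (m == i)) || ((i == n) && ((m == n.-1) || (m == n)))
  | L m => (0 < i < n) && (m == i.+1)
  | Z => 0 end.

Lemma phil_D i x : phil C i x = phiD i x.
Proof.
rewrite /phil /=; case E: (fD n i x) => [y|].
  move/fD_arrow: E => E; case F: (fD n i y) => [z|].
    by move/fD_arrow: F => /(arrowD_ends E).
  by case: E => h; rewrite /phiD ?eqxx ?h ?eqxx ?orbT.
move: E; rewrite /fD /phiD; case: ifP => [hi|_].
  by case: x => [m||m] //; case: eqP => //= _ _; case: eqP => //; lia.
case: (i =P n) => [->|_]; last by case: x => [m||m]; rewrite /= ?andbF.
case: x => [m||m] //=.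
by case: eqP => //; case: eqP.
Qed.

Lemma epsl_D i x : epsl C i x = epsD i x.
Proof.
rewrite /epsl /=; case E: (eD n i x) => [y|].
  move/eD_arrow: E => E; case F: (eD n i y) => [z|].
    by move/eD_arrow: F => /arrowD_ends /(_ E).
  by case: E => h; rewrite /epsD ?eqxx ?h ?eqxx ?orbT.
move: E; rewrite /eD /epsD; case: ifP => [hi|_].
  by case: x => [m||m] //; case: eqP => //= _ _; case: eqP => //; lia.
case: (i =P n) => [->|_]; last by case: x => [m||m]; rewrite /= ?andbF.
case: x => [m||m] //=.
by case: eqP => //; case: eqP.
Qed.

Lemma regular_D : regular C.
Proof.
split=> [i x y|i x y] /=; first by rewrite fD_arrow eD_arrow.
by move/fD_arrow; rewrite !phil_D !epsl_D; case=> h /=; lia.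
Qed.

Definition htl_D x := match x with L m => m | Bar m => n.*2 - m | Z => 0 end.
Definition ht_D (w : word) := sumn (map htl_D w).

Lemma fw_htD i u v : fw C i u = Some v -> ht_D v = (ht_D u).+1.
Proof.
have hx x y : fD n i x = Some y -> htl_D y = (htl_D x).+1.
  by move/fD_arrow; case=> /=; lia.
elim: u v => [|x u IH] v //=; case: ifP => _.
  by case E: (fD n i x) => [y|] //= [<-]; rewrite /ht_D /= (hx _ _ E).
by case E: (fw C i u) => [z|] //= [<-]; rewrite /ht_D /= -/(ht_D _) (IH _ E) addnS.
Qed.

End TypeD.

(** * Weights *)

Section Weight.
Variable C : vcrystal.

Definition Phi k (w : word) := sumn (map (phil C k) w).
Definition Eps k (w : word) := sumn (map (epsl C k) w).

(** The weight coordinate phi_k - eps_k is additive over the letters, although phi_k and eps_k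
    themselves are not. *)
Lemma phi_eps k w : phiw C k w + Eps k w = epsw C k w + Phi k w.
Proof. rewrite /Phi /Eps; elim: w => [|x w IH] //=; lia. Qed.

Hypothesis letter_weight : forall i k x y x' y', cf C i x = Some y -> cf C i x' = Some y' ->
  phil C k x + epsl C k y + phil C k y' + epsl C k x' =
  phil C k y + epsl C k x + phil C k x' + epsl C k y'.

Lemma fw_letter i u v : fw C i u = Some v -> exists x y, cf C i x = Some y /\
  forall k, Phi k v + phil C k x = Phi k u + phil C k y /\
            Eps k v + epsl C k x = Eps k u + epsl C k y.
Proof.
elim: u v => [|x u IH] v //=; case: ifP => _.
  by case E: (cf C i x) => [y|] //= [<-]; exists x, y; split=> // k; rewrite /Phi /Eps /=; lia.
case E: (fw C i u) => [z|] //= [<-]; have [a [b [Eab H]]] := IH _ E.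
by exists a, b; split=> // k; have := H k; rewrite /Phi /Eps /=; lia.
Qed.

Lemma fw_weight i k u v u' v' : fw C i u = Some v -> fw C i u' = Some v' ->
  phiw C k u + epsw C k v + phiw C k v' + epsw C k u' =
  phiw C k v + epsw C k u + phiw C k u' + epsw C k v'.
Proof.
move=> /fw_letter [x [y [E H]]] /fw_letter [x' [y' [E' H']]].
have := letter_weight k E E'; have := H k; have := H' k.
have := phi_eps k u; have := phi_eps k v; have := phi_eps k u'; have := phi_eps k v'; lia.
Qed.

End Weight.

(** * Pairs of colours whose letters form the A2 crystal and its dual *)

Section DiamondOfStrings.
Variables (C : vcrystal) (i j : nat) (a0 a1 a2 b0 b1 b2 : letter).
Hypothesis Creg : regular C.
Hypothesis abU : uniq [:: a0; a1; a2; b0; b1; b2].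
Hypothesis fi : forall x y, cf C i x = Some y <-> x = a0 /\ y = a1 \/ x = b1 /\ y = b2.
Hypothesis fj : forall x y, cf C j x = Some y <-> x = a1 /\ y = a2 \/ x = b0 /\ y = b1.

Definition shift3 x := match x with L m => L m.+3 | Bar m => Bar m.+3 | Z => Z end.
(** The default value moves every other letter beyond the six letters of type A2, which keeps it
    isolated and the map injective. *)
Definition to_A2 x :=
  nth (shift3 x) [:: L 0; L 1; L 2; Bar 0; Bar 1; Bar 2] (index x [:: a0; a1; a2; b0; b1; b2]).

Lemma to_A2E : [/\ to_A2 a0 = L 0, to_A2 a1 = L 1 & to_A2 a2 = L 2] /\
  [/\ to_A2 b0 = Bar 0, to_A2 b1 = Bar 1 & to_A2 b2 = Bar 2].
Proof.
have H x k : k < 6 -> nth Z [:: a0; a1; a2; b0; b1; b2] k = x ->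
    to_A2 x = nth (shift3 x) [:: L 0; L 1; L 2; Bar 0; Bar 1; Bar 2] k.
  by move=> hk <-; rewrite /to_A2 index_uniq.
by split; split; [apply: (H _ 0)|apply: (H _ 1)|apply: (H _ 2)|apply: (H _ 3)|apply: (H _ 4)|apply: (H _ 5)].
Qed.

Lemma to_A2_other x : x \notin [:: a0; a1; a2; b0; b1; b2] -> to_A2 x = shift3 x.
Proof. by move=> hx; rewrite /to_A2 nth_default // leqNgt index_mem. Qed.

Lemma to_A2P x : [\/ x = a0, x = a1 | x = a2] \/ [\/ x = b0, x = b1 | x = b2] \/
  (x \notin [:: a0; a1; a2; b0; b1; b2] /\ to_A2 x = shift3 x).
Proof.
case: (boolP (x \in [:: a0; a1; a2; b0; b1; b2])) => [|hx]; last first.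
  by right; right; split=> //; exact: to_A2_other.
rewrite !inE; case/orP=> [/eqP|]; first by left; constructor 1.
case/orP=> [/eqP|]; first by left; constructor 2.
case/orP=> [/eqP|]; first by left; constructor 3.
case/orP=> [/eqP|]; first by right; left; constructor 1.
by case/orP=> /eqP; right; left; [constructor 2|constructor 3].
Qed.

Lemma to_A2_inj : injective to_A2.
Proof.
have [[e0 e1 e2] [d0 d1 d2]] := to_A2E.
move=> x y; case: (to_A2P x) => [[]->|[[]->|[_ ->]]]; case: (to_A2P y) => [[]->|[[]->|[_ ->]]];
  rewrite ?e0 ?e1 ?e2 ?d0 ?d1 ?d2 //; try by case: (x).
- by case: (y).
- by case: (y).
- by case: (y).
- by case: (y).
- by case: (y).
- by case: (y).
- by case: x => [?||?]; case: y => [?||?] //= [->].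
Qed.

Lemma diamond_strings : diamond C i j.
Proof.
have [[e0 e1 e2] [d0 d1 d2]] := to_A2E.
have none (f : letter -> option letter) x : (forall y, f x = Some y -> False) -> f x = None.
  by case: (f x) => // y /(_ _ erefl).
have neq : [&& a0 != a1, a0 != a2, a0 != b0, a0 != b1, a0 != b2, a1 != a2, a1 != b0, a1 != b1,
    a1 != b2, a2 != b0, a2 != b1, a2 != b2, b0 != b1, b0 != b2 & b1 != b2].
  by move: abU; rewrite /= !inE !negb_or ?andbT -!andbA.
do 14 (case/andP: neq => /eqP ? neq); move/eqP: neq => ?.
have [R _] := Creg.
apply: (diamond_map (rho := to_A2) Creg regular_A2 to_A2_inj _ _ _ _ _ diamond_A2) => // x /=.
- case: (to_A2P x) => [[]->|[[]->|[hx ->]]]; rewrite ?e0 ?e1 ?e2 ?d0 ?d1 ?d2 /=.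
  + by have -> : cf C i a0 = Some a1; [apply/fi; left|rewrite /= e1].
  + by rewrite none // => y /fi [] []; congruence.
  + by rewrite none // => y /fi [] []; congruence.
  + by rewrite none // => y /fi [] []; congruence.
  + by have -> : cf C i b1 = Some b2; [apply/fi; right|rewrite /= d2].
  + by rewrite none // => y /fi [] []; congruence.
  + rewrite (none (cf C i)); first by case: (x).
    by move=> y /fi [] [] Ex _; move: hx; rewrite Ex !inE eqxx /= ?orbT.
- case: (to_A2P x) => [[]->|[[]->|[hx ->]]]; rewrite ?e0 ?e1 ?e2 ?d0 ?d1 ?d2 /=.
  + by rewrite none // => y /R /fi [] []; congruence.
  + by have -> : ce C i a1 = Some a0; [apply/R/fi; left|rewrite /= e0].
  + by rewrite none // => y /R /fi [] []; congruence.
  + by rewrite none // => y /R /fi [] []; congruence.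
  + by rewrite none // => y /R /fi [] []; congruence.
  + by have -> : ce C i b2 = Some b1; [apply/R/fi; right|rewrite /= d1].
  + rewrite (none (ce C i)); first by case: (x).
    by move=> y /R /fi [] [] _ Ex; move: hx; rewrite Ex !inE eqxx /= ?orbT.
- case: (to_A2P x) => [[]->|[[]->|[hx ->]]]; rewrite ?e0 ?e1 ?e2 ?d0 ?d1 ?d2 /=.
  + by rewrite none // => y /fj [] []; congruence.
  + by have -> : cf C j a1 = Some a2; [apply/fj; left|rewrite /= e2].
  + by rewrite none // => y /fj [] []; congruence.
  + by have -> : cf C j b0 = Some b1; [apply/fj; right|rewrite /= d1].
  + by rewrite none // => y /fj [] []; congruence.
  + by rewrite none // => y /fj [] []; congruence.
  + rewrite (none (cf C j)); first by case: (x).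
    by move=> y /fj [] [] Ex _; move: hx; rewrite Ex !inE eqxx /= ?orbT.
- case: (to_A2P x) => [[]->|[[]->|[hx ->]]]; rewrite ?e0 ?e1 ?e2 ?d0 ?d1 ?d2 /=.
  + by rewrite none // => y /R /fj [] []; congruence.
  + by rewrite none // => y /R /fj [] []; congruence.
  + by have -> : ce C j a2 = Some a1; [apply/R/fj; left|rewrite /= e1].
  + by rewrite none // => y /R /fj [] []; congruence.
  + by have -> : ce C j b1 = Some b0; [apply/R/fj; right|rewrite /= d0].
  + by rewrite none // => y /R /fj [] []; congruence.
  + rewrite (none (ce C j)); first by case: (x).
    by move=> y /R /fj [] [] _ Ex; move: hx; rewrite Ex !inE eqxx /= ?orbT.
Qed.

End DiamondOfStrings.

(** * Diamonds of type D and their consequences *)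

Section TypeD.
Variable n : nat.
Hypothesis hn : 2 <= n.
Let C := cD n.

(** The edges of the Dynkin diagram, oriented towards the larger index. *)
Definition adjacentD i j := ((j < n) && (j == i.+1)) || ((j == n) && (n == i.+2)).

Lemma arrowD_comm i j x u y : i != j -> ~~ adjacentD i j -> ~~ adjacentD j i ->
  arrowD n j x u -> arrowD n i u y -> exists2 v, arrowD n i x v & arrowD n j v y.
Proof.
move=> nij h1 h2 H1 H2; inversion H1; inversion H2; subst; rewrite /adjacentD in h1 h2; try lia.
all: try match goal with H : L _ = L _ |- _ => case: H => ? end.
all: try match goal with H : Bar _ = Bar _ |- _ => case: H => ? end; try lia.
all: try discriminate.
(* The only composable arrows left have colours n-1 and n: both orders lead from [L n.-1] to
   [Bar n.-1], one through [L n] and the other through [Bar n]. *)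
- have -> : j = n.-1 by lia.
  exists (Bar n); first exact: ArrL'.
  by have := @ArrB n n.-1 ltac:(lia); rewrite prednK //; lia.
- have -> : i = n.-1 by lia.
  exists (L n); last exact: ArrB'.
  by have := @ArrL n n.-1 ltac:(lia); rewrite prednK //; lia.
Qed.

Lemma inert_D (i j : nat) : i != j -> ~~ adjacentD i j -> ~~ adjacentD j i -> inert C i j.
Proof.
rewrite /adjacentD => nij h1 h2 x y /(fD_arrow hn) H; rewrite !phil_D // !epsl_D //.
by case: H => h /=; split; lia.
Qed.

Lemma diamond_D i j : 1 <= i <= n -> 1 <= j <= n -> i != j -> diamond C i j.
Proof.
have adj a b : 1 <= a <= n -> 1 <= b <= n -> adjacentD a b -> diamond C a b.
  move=> ha hb /orP [/andP [hbn /eqP Eb]|/andP [/eqP Eb /eqP En]].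
    apply: (@diamond_strings C a b (L a) (L a.+1) (L a.+2) (Bar a.+2) (Bar a.+1) (Bar a)).
    + exact: regular_D.
    + by rewrite /= !inE !eqE /=; lia.
    + move=> x y; rewrite /= fD_arrow //; split=> [[]|[] [-> ->]]; try lia; try by [left|right].
        by apply: ArrL; lia.
      by apply: ArrB; lia.
    + rewrite Eb; move=> x y; rewrite /= fD_arrow //; split=> [[]|[] [-> ->]]; try lia; try by [left|right].
        by apply: ArrL; lia.
      by apply: ArrB; lia.
  (* For the colours n-2 and n, the two chains are those of n-2 and n-1 with [L n] and [Bar n]
     exchanged. *)
  apply: (@diamond_strings C a b (L a) (L a.+1) (Bar a.+2) (L a.+2) (Bar a.+1) (Bar a)).
  + exact: regular_D.
  + by rewrite /= !inE !eqE /=; lia.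
  + move=> x y; rewrite /= fD_arrow //; split=> [[]|[] [-> ->]]; try lia; try by [left|right].
      by apply: ArrL; lia.
    by apply: ArrB; lia.
  + move=> x y; rewrite Eb /= fD_arrow //; split; first by case=> h; [lia|lia|left|right]; rewrite En.
    have E1 : a.+1 = n.-1 by lia.
    by rewrite -En E1; case=> [] [-> ->]; [apply: ArrL'|apply: ArrB'].
move=> hi hj nij.
case: (boolP (adjacentD i j)) => [/(adj _ _ hi hj) //|h1].
case: (boolP (adjacentD j i)) => [/(adj _ _ hj hi)/diamond_sym //|h2].
have nji : j != i by rewrite eq_sym.
apply: (diamond_comm (regular_D hn)); [exact: inert_D|exact: inert_D|].
have half a b : a != b -> ~~ adjacentD a b -> ~~ adjacentD b a -> forall x y,
    obind (cf C a) (cf C b x) = Some y -> obind (cf C b) (cf C a x) = Some y.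
  move=> nab k1 k2 x y /=; case E: (fD n b x) => [u|] //= /(fD_arrow hn) F.
  move/(fD_arrow hn): E => E; have [v /(fD_arrow hn) -> /(fD_arrow hn) H] := arrowD_comm nab k1 k2 E F.
  exact: H.
move=> x; case E: (obind (cf C i) _) => [y|]; first by rewrite (half _ _ nij h1 h2 _ _ E).
case F: (obind (cf C j) _) => [y|] //.
by rewrite (half _ _ nji h2 h1 _ _ F) in E.
Qed.

Lemma letter_weight_D i k x y x' y' : cf C i x = Some y -> cf C i x' = Some y' ->
  phil C k x + epsl C k y + phil C k y' + epsl C k x' =
  phil C k y + epsl C k x + phil C k x' + epsl C k y'.
Proof.
have eB k' m : epsD n k' (Bar m) = phiD n k' (L m) by [].
have pB k' m : phiD n k' (Bar m) = epsD n k' (L m) by [].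
move=> /(fD_arrow hn) H /(fD_arrow hn) H'; rewrite !phil_D // !epsl_D //.
by case: H => h; case: H' => h'; rewrite ?eB ?pB; lia.
Qed.

Lemma top_unique_D w h h' : top C w h -> top C w h' -> h = h'.
Proof.
apply: (top_unique (regular_D hn) (fw_htD hn)) => i j hi hj; exact: diamond_D.
Qed.

Lemma highest_iso_D h1 h2 : highest C h1 -> highest C h2 -> same_phi C h1 h2 ->
  iso C (idx C) h1 h2.
Proof.
apply: (highest_iso (regular_D hn) (fw_htD hn)).
  by move=> i j hi hj; exact: diamond_D.
by move=> i k u v u' v'; apply: fw_weight; exact: letter_weight_D.
Qed.

End TypeD.

(** * Type B as a virtual crystal of type D *)

Section TypeB.
Variable n : nat.
Hypothesis hn : 2 <= n.
Let C := cB n.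

Inductive arrowB (i : nat) : letter -> letter -> Prop :=
  | ArrBL of 0 < i < n : arrowB i (L i) (L i.+1)
  | ArrBB of 0 < i < n : arrowB i (Bar i.+1) (Bar i)
  | ArrBLZ of i = n : arrowB i (L n) Z
  | ArrBZB of i = n : arrowB i Z (Bar n).

Lemma fB_arrow i x y : fB n i x = Some y <-> arrowB i x y.
Proof.
split.
  rewrite /fB; case: ifP => [hi|_]; first by
    case: x => [m||m] //; case: eqP => // -> [<-]; [exact: ArrBL|exact: ArrBB].
  case: eqP => // hi; case: x => [m||m] //; last by case=> <-; exact: ArrBZB.
  by case: eqP => // -> [<-]; exact: ArrBLZ.
by rewrite /fB; case=> [h|h|->|->]; rewrite ?h ?eqxx // ltnn andbF // eqxx.
Qed.

Lemma eB_arrow i x y : eB n i y = Some x <-> arrowB i x y.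
Proof.
split.
  rewrite /eB; case: ifP => [hi|_]; first by
    case: y => [m||m] //; case: eqP => // -> [<-]; [exact: ArrBL|exact: ArrBB].
  case: eqP => // hi; case: y => [m||m] //; first by case=> <-; exact: ArrBLZ.
  by case: eqP => // -> [<-]; exact: ArrBZB.
by rewrite /eB; case=> [h|h|->|->]; rewrite ?h ?eqxx // ltnn andbF // eqxx.
Qed.

Definition phiB i x : nat := match x with
  | L m => ((0 < i < n) && (m == i)) + ((i == n) && (m == n)).*2
  | Bar m => (0 < i < n) && (m == i.+1)
  | Z => i == n end.

Definition epsB i x : nat := match x with
  | Bar m => ((0 < i < n) && (m == i)) + ((i == n) && (m == n)).*2
  | L m => (0 < i < n) && (m == i.+1)
  | Z => i == n end.

Lemma phil_B i x : phil C i x = phiB i x.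
Proof.
rewrite /phil /= /fB /phiB; case: (ltngtP i n) => [hi|hi|->] /=; rewrite ?andbF ?andbT //=.
  case: (ltnP 0 i) => h0 //=; last by case: x.
  by case: x => [m||m] //; case: eqP => // _ /=; case: eqP => //; lia.
  by case: x.
by case: x => [m||m] //; rewrite ?eqxx //; case: eqP.
Qed.

Lemma epsl_B i x : epsl C i x = epsB i x.
Proof.
rewrite /epsl /= /eB /epsB; case: (ltngtP i n) => [hi|hi|->] /=; rewrite ?andbF ?andbT //=.
  case: (ltnP 0 i) => h0 //=; last by case: x.
  by case: x => [m||m] //; case: eqP => // _ /=; case: eqP => //; lia.
  by case: x.
by case: x => [m||m] //; rewrite ?eqxx //; case: eqP.
Qed.

Lemma regular_B : regular C.
Proof.
split=> [i x y|i x y] /=; first by rewrite fB_arrow eB_arrow.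
by move/fB_arrow; rewrite !phil_B !epsl_B; case=> h /=; lia.
Qed.

Definition ht_B (w : word) := sumn (map (rankB n) w).

Lemma fw_htB i u v : fw C i u = Some v -> ht_B v = (ht_B u).+1.
Proof.
have hx x y : fB n i x = Some y -> rankB n y = (rankB n x).+1.
  by move/fB_arrow; case=> /=; lia.
elim: u v => [|x u IH] v //=; case: ifP => _.
  by case E: (fB n i x) => [y|] //= [<-]; rewrite /ht_B /= (hx _ _ E).
by case E: (fw C i u) => [z|] //= [<-]; rewrite /ht_B /= -/(ht_B _) (IH _ E) addnS.
Qed.

Let D := cD n.+1.
Let hn1 : 2 <= n.+1. Proof. by rewrite ltnW. Qed.

(* The virtual image of the vector crystal of type B_n in the tensor square of that of type D_(n+1).
   [bump] keeps the letters outside of the alphabet isolated. *)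
Definition virt (x : letter) : word := match x with
  | L m => [:: L (bump n.+1 m); L (bump n.+1 m)]
  | Z => [:: Bar n; L n]
  | Bar m => [:: Bar (bump n.+1 m); Bar (bump n.+1 m)]
  end.
Definition virtw (w : word) : word := flatten (map virt w).

(** The operator of colour i is realized by the colours [fold2 i] and then [i]; string lengths are
    thereby multiplied by [scale i]. The last string of type B already has length two, which is why
    the factor at n is 1. *)
Definition scale i := if i == n then 1 else 2.
Definition fold2 i := if i == n then n.+1 else i.

Lemma scale_gt0 i : 0 < scale i.
Proof. by rewrite /scale; case: ifP. Qed.

Lemma virt_str i x : 1 <= i <= n ->
  [/\ epsw D i (virt x) = scale i * epsl C i x, phiw D i (virt x) = scale i * phil C i x,
      epsw D (fold2 i) (virt x) = scale i * epsl C i x &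
      phiw D (fold2 i) (virt x) = scale i * phil C i x].
Proof.
move=> hi; rewrite phil_B epsl_B /scale /fold2; case: (eqVneq i n) => hin.
  rewrite hin; case: x => [m||m] /=; rewrite !phil_D // !epsl_D //= /bump.
  - by case: (leqP n.+1 m) => hm; split; lia.
  - by split; lia.
  - by case: (leqP n.+1 m) => hm; split; lia.
case: x => [m||m] /=; rewrite !phil_D // !epsl_D //= /bump.
- by case: (leqP n.+1 m) => hm; split; lia.
- by split; lia.
- by case: (leqP n.+1 m) => hm; split; lia.
Qed.

Lemma virtw_str i w : 1 <= i <= n ->
  [/\ epsw D i (virtw w) = scale i * epsw C i w, phiw D i (virtw w) = scale i * phiw C i w,
      epsw D (fold2 i) (virtw w) = scale i * epsw C i w &
      phiw D (fold2 i) (virtw w) = scale i * phiw C i w].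
Proof.
move=> hi; elim: w => [|x w [e1 p1 e2 p2]] /=; first by rewrite muln0.
rewrite /virtw /= -/(virtw w) !epsw_cat !phiw_cat e1 p1 e2 p2; have [-> -> -> ->] := virt_str x hi.
by rewrite -!mulnBr -!mulnDr.
Qed.

Lemma fw_left (E : vcrystal) i x x' y : cf E i x = Some x' -> epsl E i y < phil E i x ->
  fw E i [:: x; y] = Some [:: x'; y].
Proof. by move=> Ex h /=; rewrite sub0n addn0 h Ex. Qed.

Lemma fw_right (E : vcrystal) i x y y' : cf E i y = Some y' -> phil E i x <= epsl E i y ->
  fw E i [:: x; y] = Some [:: x; y'].
Proof.
move=> Ey h; rewrite -cat1s fw_cat fw1 (fw1 _ _ y) Ey phiw1 epsw1 ltnNge h //.
Qed.

Lemma virt_fw i x y : cf C i x = Some y -> fseq D [:: i; fold2 i] (virt x) = Some (virt y).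
Proof.
have lt_bump m : m <= n -> bump n.+1 m = m by rewrite /bump; case: leqP => //; lia.
have two k k' u m v : fw D k' u = Some m -> fw D k m = Some v -> fseq D [:: k; k'] u = Some v.
  by rewrite /fseq /= => ->.
rewrite /fold2 => /fB_arrow [h|h|->|->]; rewrite ?eqxx ?ifF /virt ?lt_bump //; try lia.
- apply: (two _ _ _ [:: L i.+1; L i]); [apply: fw_left|apply: fw_right].
  + by apply/fD_arrow => //; apply: ArrL; lia.
  + by rewrite phil_D // epsl_D //=; lia.
  + by apply/fD_arrow => //; apply: ArrL; lia.
  + by rewrite phil_D // epsl_D //=; lia.
- apply: (two _ _ _ [:: Bar i; Bar i.+1]); [apply: fw_left|apply: fw_right].
  + by apply/fD_arrow => //; apply: ArrB; lia.
  + by rewrite phil_D // epsl_D //=; lia.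
  + by apply/fD_arrow => //; apply: ArrB; lia.
  + by rewrite phil_D // epsl_D //=; lia.
- apply: (two _ _ _ [:: Bar n.+1; L n]); apply: fw_left.
  + by apply/fD_arrow => //; apply: ArrL'.
  + by rewrite phil_D // epsl_D //=; lia.
  + by apply/fD_arrow => //; apply: ArrB; lia.
  + by rewrite phil_D // epsl_D //=; lia.
- apply: (two _ _ _ [:: Bar n; Bar n.+1]); apply: fw_right.
  + by apply/fD_arrow => //; apply: ArrL'.
  + by rewrite phil_D // epsl_D //=; lia.
  + by apply/fD_arrow => //; apply: ArrB; lia.
  + by rewrite phil_D // epsl_D //=; lia.
Qed.

(** All string lengths are scaled by the same factor, so the comparisons in the tensor rule agree
    with those of type B. They survive the first of the two operators, so both act on the image of
    the same letter. *)
Lemma virtw_fw i w w' : 1 <= i <= n -> fw C i w = Some w' ->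
  fseq D [:: i; fold2 i] (virtw w) = Some (virtw w').
Proof.
move=> hi; rewrite /fseq /=; elim: w w' => [|x w IH] w' //; rewrite [fw _ _ _]/=.
have [e1 p1 e2 p2] := virtw_str w hi; have [a1 b1 a2 b2] := virt_str x hi.
have sg := scale_gt0 i.
case: ifP => h.
  case E: (fB n i x) => [y|] //= [<-]; rewrite /virtw /= -/(virtw w) fw_cat e2 b2 ltn_pmul2l // h.
  have := virt_fw E; rewrite /fseq /=; case F2: (fw D (fold2 i) _) => [m|] //= F1.
  have [_ hp] := fw_stat (regular_D hn1) F1; have [_ q1 _ _] := virt_str y hi.
  have [_ /(_ _ _ _ E) [hx _]] := regular_B.
  rewrite fw_cat e1 hp q1 F1 ifT //.
  rewrite ltnS leq_pmul2l //; lia.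
case E: (fw C i w) => [u|] //= [<-]; rewrite /virtw /= -/(virtw w) fw_cat e2 b2 ltn_pmul2l // h.
have := IH _ E; case F2: (fw D (fold2 i) _) => [m|] //= F1.
have [hp _] := fw_stat (regular_D hn1) F1; have [q1 _ _ _] := virtw_str u hi.
have [hx _] := fw_stat regular_B E.
rewrite fw_cat F1 ifF //; apply/negbTE; rewrite -leqNgt b1.
have h' : phil C i x <= epsw C i w by rewrite leqNgt h.
have : scale i * phil C i x <= scale i * epsw C i w by rewrite leq_mul2l h' orbT.
have : scale i * epsw C i w + scale i = (epsw D i m).+1 by rewrite -hp q1 hx mulnS addnC.
lia.
Qed.

Lemma virt_inj : injective virt.
Proof.
move=> [m||m] [k||k] //= [].
  by move=> /(can_inj (bumpK _)) ->.
by move=> /(can_inj (bumpK _)) ->.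
Qed.

Lemma virtw_inj : injective virtw.
Proof.
elim=> [|x w IH] [|y w'] //; rewrite /virtw /=; [by case: y|by case: x|].
move=> /eqP; rewrite eqseq_cat; last by case: (x); case: (y).
by case/andP=> /eqP /virt_inj -> /eqP /IH ->.
Qed.

Lemma idx_fold2 i : idx C i -> all (idx D) [:: i; fold2 i].
Proof. by rewrite /idx /fold2 /=; case: ifP; lia. Qed.

Lemma virtw_fseq s h w : all (idx C) s -> fseq C s h = Some w ->
  exists2 s', all (idx D) s' & fseq D s' (virtw h) = Some (virtw w).
Proof.
elim: s w => [|i s IH] w; first by move=> _ [->]; exists [::].
case/andP=> hi hs; rewrite fseq_cons; case E: (fseq C s h) => [u|] //= Eu.
have [s' hs' E'] := IH _ hs E.
exists ([:: i; fold2 i] ++ s'); first by rewrite all_cat idx_fold2.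
by rewrite fseq_cat E'; exact: virtw_fw.
Qed.

Lemma virtw_highest h : highest C h -> highest D (virtw h).
Proof.
move=> hh; apply: eps_highest => k; rewrite /idx /= => hk.
have he i : 1 <= i <= n -> epsw C i h = 0 by move=> hi; exact: highest_eps hh hi.
case: (leqP k n) => hkn.
  have hk' : 1 <= k <= n by lia.
  by have [-> _ _ _] := virtw_str h hk'; rewrite he // muln0.
have hnn : 1 <= n <= n by lia.
have -> : k = fold2 n by rewrite /fold2 eqxx; lia.
by have [_ _ -> _] := virtw_str h hnn; rewrite he // muln0.
Qed.

Lemma top_unique_B w h h' : top C w h -> top C w h' -> h = h'.
Proof.
move=> [hh [s hs Es]] [hh' [s' hs' Es']]; apply: virtw_inj.
apply: (top_unique_D hn1 (w := virtw w)); split; try exact: virtw_highest.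
  exact: virtw_fseq Es.
exact: virtw_fseq Es'.
Qed.

Lemma fseq_inj (E : vcrystal) s u u' v : regular E ->
  fseq E s u = Some v -> fseq E s u' = Some v -> u = u'.
Proof.
move=> rE; elim: s v => [|i s IH] v; first by move=> [->] [->].
rewrite !fseq_cons; case F: (fseq E s u) => [w|] //= Fw; case F': (fseq E s u') => [w'|] //= Fw'.
by apply: (IH w) => //; rewrite (fw_inj rE Fw Fw').
Qed.

(** The isomorphism of the virtual images is restricted to words of the form [virtw u]. Equal string
    lengths, after cancelling the scale, ensure that an operator of type B is defined on both sides
    at once, and its virtual path is then transported. *)
Lemma highest_iso_B h1 h2 : highest C h1 -> highest C h2 -> same_phi C h1 h2 ->
  iso C (idx C) h1 h2.
Proof.
move=> hh1 hh2 hphi.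
have [R hR R12] : iso D (idx D) (virtw h1) (virtw h2).
  apply: (highest_iso_D hn1); try exact: virtw_highest.
  move=> k; rewrite /idx /= => hk; case: (leqP k n) => hkn.
    have hk' : 1 <= k <= n by lia.
    by have [_ -> _ _] := virtw_str h1 hk'; have [_ -> _ _] := virtw_str h2 hk'; rewrite hphi.
  have hnn : 1 <= n <= n by lia.
  have -> : k = fold2 n by rewrite /fold2 eqxx; lia.
  by have [_ _ _ ->] := virtw_str h1 hnn; have [_ _ _ ->] := virtw_str h2 hnn; rewrite hphi.
have str u u' i : R (virtw u) (virtw u') -> idx C i -> epsw C i u = epsw C i u' /\ phiw C i u = phiw C i u'.
  move=> Ruu hi; have hiD : idx D i by move: hi; rewrite /idx /=; lia.
  have [ee pp] := cb_str hR Ruu hiD.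
  have [e1 p1 _ _] := virtw_str u hi; have [e2 p2 _ _] := virtw_str u' hi.
  move: ee pp; rewrite e1 e2 p1 p2 => /eqP ee /eqP pp; have sg := scale_gt0 i.
  by move: ee pp; rewrite !eqn_pmul2l // => /eqP ? /eqP.
exists (fun u u' => R (virtw u) (virtw u')) => //; split.
- exact: str.
- move=> u u' i v Ruu hi E; have [_ pp] := str _ _ _ Ruu hi.
  have [|v' E'] := @fw_some C i u'; first by rewrite -pp (fw_phi_gt0 E).
  exists v' => //; have [w Ew Rw] := cb_fseq hR Ruu (idx_fold2 hi) (virtw_fw hi E).
  by move: Ew; rewrite (virtw_fw hi E') => -[->].
- move=> u u' i v Ruu hi E; have [ee _] := str _ _ _ Ruu hi.
  have [|v' E'] := @ew_some C i u'; first by rewrite -ee (ew_eps_gt0 E).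
  exists v' => //; move/(fw_ew regular_B): E => E; move/(fw_ew regular_B): E' => E'.
  have [w Ew Rw] := cb_eseq (regular_D hn1) hR Ruu (idx_fold2 hi) (virtw_fw hi E).
  by rewrite (fseq_inj (regular_D hn1) (virtw_fw hi E') Ew).
- by move=> u v v' /(cb_fun hR) H /H /virtw_inj.
- by move=> u v v' /(cb_inj hR) H /H /virtw_inj.
Qed.

End TypeB.

(** * Components and shapes *)

Section Components.
Variable C : vcrystal.
Hypothesis Creg : regular C.
Variable ht : word -> nat.
Hypothesis fw_ht : forall i u v, fw C i u = Some v -> ht v = (ht u).+1.
Hypothesis Ctop : forall w h h', top C w h -> top C w h' -> h = h'.
Hypothesis Ciso : forall h1 h2, highest C h1 -> highest C h2 -> same_phi C h1 h2 ->
  iso C (idx C) h1 h2.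

Lemma conn_top u v h : conn C u v -> top C u h -> top C v h.
Proof.
move=> huv; have [H _] : top C u h <-> top C v h; last exact: H.
apply: (conn_ind_inv (P := fun w => top C w h)) huv => i a b Ji E; split; first exact: top_fw E.
have [h0 T0] := top_exists Creg fw_ht a => Tb; have T0b := top_fw Ji E T0.
by rewrite (Ctop Tb T0b).
Qed.

Lemma top_conn w h : top C w h -> conn C h w.
Proof. by case=> _ [s hs /conn_fseq]; exact. Qed.

Lemma conn_highest h w : highest C h -> conn C h w -> top C w h.
Proof. by move=> hh hw; apply: conn_top hw _; exact: top_self. Qed.

Lemma highest_eq h h' w : highest C h -> highest C h' -> conn C h w -> conn C h' w -> h = h'.
Proof. by move=> hh hh' /(conn_highest hh) T /(conn_highest hh') T'; exact: Ctop T T'. Qed.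

Lemma fseq_nseq_phi k m u : (fseq C (nseq m k) u == None) = (phiw C k u < m).
Proof.
elim: m => [|m IH] //; rewrite -[nseq m.+1 k]/(k :: nseq m k) fseq_cons.
case E: (fseq C (nseq m k) u) IH => [v|] IH /=.
  by rewrite fw_none (fseq_count_phi Creg E) ltnS -[X in _ <= X]add0n leq_add2r leqn0.
by rewrite ltnS ltnW // -IH.
Qed.

Lemma iso_comp_phi h1 h2 : highest C h1 -> highest C h2 -> iso_comp C h1 h2 -> same_phi C h1 h2.
Proof.
move=> hh1 hh2 [psi [p1 [p2 [p3 p4]]]].
have pf s u : all (idx C) s -> conn C h1 u -> fseq C s (psi u) = omap psi (fseq C s u).
  move=> + hu; elim: s => [|i s IH] //= /andP [hi hs]; rewrite -!/(fseq C s _) IH //.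
  by case E: (fseq C s u) => [v|] //=; rewrite p4 //; apply: conn_trans hu (conn_fseq hs E).
(* The path from [h1] to the preimage of [h2] is mapped to a path from [psi h1] to [h2], while
   [psi h1] lies below [h2]; comparing heights, the path is empty. *)
have E1 : psi h1 = h2.
  have [u [hu Eu]] := p3 _ (conn_refl C h2).
  have [_ [t ht' Et]] := conn_highest hh1 hu.
  have [_ [r hr Er]] := conn_highest hh2 (p1 _ (conn_refl C h1)).
  have := pf t h1 ht' (conn_refl C h1); rewrite Et /= Eu => Ept.
  have := fseq_ht fw_ht Ept; have := fseq_ht fw_ht Er => q1 q2.
  by case: t Ept {Et ht'} q2 => [[]//|? ?] _ /=; lia.
move=> k hk; have e m : (phiw C k h1 < m) = (phiw C k h2 < m).
  have hn : all (idx C) (nseq m k) by rewrite all_nseq hk orbT.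
  rewrite -!fseq_nseq_phi -E1 (pf _ _ hn (conn_refl C h1)).
  by case: (fseq C _ h1).
apply/eqP; rewrite eqn_leq; apply/andP; split; first by rewrite -ltnS e.
by rewrite -ltnS -e.
Qed.

Lemma iso_iso_comp h1 h2 : highest C h1 -> highest C h2 -> iso C (idx C) h1 h2 -> iso_comp C h1 h2.
Proof.
move=> hh1 hh2 [R hR R12].
(* Choice turns the relation into a function, which is constrained on the component of [h1] only. *)
pose psi u := epsilon (inhabits u) (R u).
have Rpsi u u' : R u u' -> psi u = u'.
  move=> Ruu; have Rp : R u (psi u) by exact: epsilon_spec (ex_intro _ u' Ruu).
  exact: cb_fun hR _ _ _ Rp Ruu.
have down u : conn C h1 u -> exists2 u', R u u' & conn C h2 u'.
  move=> /(conn_highest hh1) [_ [s hs Es]].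
  have [u' E' Ru] := cb_fseq hR R12 hs Es; exists u' => //; exact: conn_fseq E'.
exists psi; split; last split; last split.
- by move=> u /down [u' /Rpsi ->].
- move=> u v /down [u' Ru _] /down [v' Rv _]; rewrite (Rpsi _ _ Ru) (Rpsi _ _ Rv) => Euv.
  by rewrite -Euv in Rv; exact: cb_inj hR _ _ _ Ru Rv.
- move=> v /(conn_highest hh2) [_ [s hs Es]].
  have [u E' Ru] := cb_fseq (crystal_bij_sym hR) R12 hs Es.
  by exists u; split; [exact: conn_fseq E'|exact: Rpsi].
- move=> u i /down [u' Ru hu'] hi; rewrite (Rpsi _ _ Ru).
  case E: (fw C i u) => [v|] /=.
    by have [v' -> /Rpsi ->] := cb_fw hR Ru hi E.
  apply/eqP; rewrite fw_none; have [_ <-] := cb_str hR Ru hi.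
  by rewrite -fw_none E.
Qed.

Lemma take_highest k h : highest C h -> highest C (take k h).
Proof.
move=> hh; apply: eps_highest => i hi; have := highest_eps hh hi.
by rewrite -{1}(cat_take_drop k h) epsw_cat; lia.
Qed.

Variable valid : pred letter.
Hypothesis valid_fw : forall i x y, idx C i -> cf C i x = Some y -> valid x = valid y.
(** The weights of the vector representation have multiplicity one. *)
Hypothesis letter_sep : forall x y, valid x -> valid y ->
  (forall i, idx C i -> phil C i x + epsl C i y = phil C i y + epsl C i x) -> x = y.

Lemma conn_valid u v : conn C u v -> all valid u = all valid v.
Proof.
move=> huv; have [H H'] : all valid u <-> all valid v; last by apply/idP/idP; [exact: H|exact: H'].
apply: (conn_ind_inv (P := fun w => all valid w)) huv => i a b hi.
elim: a b => [|x a IH] b //=; case: ifP => _.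
  by case E: (cf C i x) => [y|] //= [<-] /=; rewrite (valid_fw hi E).
case E: (fw C i a) => [c|] //= [<-] /=; have [h1 h2] := IH _ E.
by split=> /andP [-> h] /=; [exact: h1|exact: h2].
Qed.

(** All prefixes have highest weight, so their phi are their weights; the step from one prefix to
    the next reveals the weight of the added letter, and thus the letter. *)
Lemma highest_prefix_phi h1 h2 : size h1 = size h2 -> all valid h1 -> all valid h2 ->
  highest C h1 -> highest C h2 ->
  (forall k, 0 < k <= size h1 -> same_phi C (take k h1) (take k h2)) -> h1 = h2.
Proof.
move=> sz v1 v2 hh1 hh2 H.
have E k : k <= size h1 -> take k h1 = take k h2.
  elim: k => [|k IH] hk; first by rewrite !take0.
  have hk2 : k < size h2 by rewrite -sz.
  have eqk := IH (ltnW hk).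
  rewrite (take_nth Z hk) (take_nth Z hk2) eqk; congr rcons.
  apply: letter_sep; [by apply/(all_nthP Z)|by apply/(all_nthP Z)|] => i hi.
  have := H k.+1; rewrite hk => /(_ isT i hi).
  have := highest_eps (take_highest k.+1 hh1) hi; have := highest_eps (take_highest k.+1 hh2) hi.
  rewrite (take_nth Z hk) (take_nth Z hk2) eqk -!cats1 !epsw_cat !phiw_cat !epsw1 !phiw1; lia.
by have := E _ (leqnn _); rewrite {2}sz !take_size.
Qed.

(** Common interface of the two types: [X] consists of the tableaux (with their signed shape in type
    D), [S] of the shapes, and [can s] is the highest weight reading for the shape [s]. With these
    data [tableau_of] is convertible to [PB] and to [PD]. *)
Variables (X S : Type) (x0 : X) (lab : X -> S) (rd : X -> word) (orth : X -> Prop)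
  (ok : S -> Prop) (can : S -> word).
Hypothesis can_highest : forall s, ok s -> highest C (can s).
Hypothesis orth_ok : forall p, orth p -> ok (lab p) /\ conn C (can (lab p)) (rd p).
Hypothesis orth_ex : forall s w, ok s -> conn C (can s) w ->
  exists p, [/\ orth p, lab p = s & rd p = w].
Hypothesis can_ex : forall h, all valid h -> highest C h -> exists2 s, ok s & same_phi C (can s) h.
Hypothesis can_inj : forall s s', ok s -> ok s' -> same_phi C (can s) (can s') -> s = s'.

Definition tableau_of w : X := epsilon (inhabits x0) (fun p => orth p /\ sim C (rd p) w).

Lemma tableau_ex w : all valid w -> exists p, orth p /\ sim C (rd p) w.
Proof.
move=> hw; have [h T] := top_exists Creg fw_ht w; have hh : highest C h by case: T.
have [|s oks hphi] := can_ex _ hh; first by rewrite (conn_valid (top_conn T)).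
have hiso := Ciso (can_highest oks) hh hphi.
case: T => _ [t ht' Et]; have [R hR Rh] := hiso.
have [w' Et' _] := cb_fseq (crystal_bij_sym hR) Rh ht' Et.
have hcw := conn_fseq ht' Et'.
have [p [op Ep Er]] := orth_ex oks hcw.
exists p; split=> //; exists (can s), h, t; rewrite Er; split; first exact: can_highest.
do !split=> //; first exact: conn_fseq Et.
by apply: iso_iso_comp => //; exact: can_highest.
Qed.

(** Whichever tableau is chosen, the highest weight vertex above its reading is [can] of its shape,
    and [sim] relates it to [h] by an isomorphism of components. The shape of P(w) therefore encodes
    the highest weight. *)
Lemma tableau_of_phi w h : all valid w -> top C w h ->
  ok (lab (tableau_of w)) /\ same_phi C (can (lab (tableau_of w))) h.
Proof.
move=> hw T; have [op] := epsilon_spec (inhabits x0) _ (tableau_ex hw).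
rewrite -/(tableau_of w) => -[h1 [h2 [s [hh1 [hh2 [c1 [c2 [hiso _]]]]]]]].
have [oks cp] := orth_ok op; split=> //.
have -> : can (lab (tableau_of w)) = h1 by apply: highest_eq cp c1 => //; exact: can_highest.
have -> : h = h2 by apply: highest_eq (top_conn T) c2 => //; case: T.
exact: iso_comp_phi.
Qed.

Theorem conn_iff_shapes w1 w2 : all valid w1 -> all valid w2 ->
  conn C w1 w2 <-> map (fun k => lab (tableau_of (take k w1))) (iota 1 (size w1)) =
                   map (fun k => lab (tableau_of (take k w2))) (iota 1 (size w2)).
Proof.
move=> v1 v2; have vt k w : all valid w -> all valid (take k w).
  by rewrite -{1}(cat_take_drop k w) all_cat => /andP [].
split=> [hc|E].
  rewrite -(conn_size hc); apply: eq_map => k.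
  have [h T1] := top_exists Creg fw_ht (take k w1).
  have T2 := conn_top (conn_take k hc) T1.
  have [o1 e1] := tableau_of_phi (vt k _ v1) T1; have [o2 e2] := tableau_of_phi (vt k _ v2) T2.
  by apply: can_inj => // i hi; rewrite e1 // e2.
have sz : size w1 = size w2 by move/(congr1 size): E; rewrite !size_map !size_iota.
have [h1 T1] := top_exists Creg fw_ht w1; have [h2 T2] := top_exists Creg fw_ht w2.
have c1 := top_conn T1; have c2 := top_conn T2.
have hh1 : highest C h1 by case: T1.
have hh2 : highest C h2 by case: T2.
suff Eh : h1 = h2 by apply: conn_trans (conn_sym c1) _; rewrite Eh.
apply: highest_prefix_phi => //.
- by rewrite (conn_size c1) (conn_size c2).
- by rewrite (conn_valid c1).
- by rewrite (conn_valid c2).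
rewrite (conn_size c1) => k hk i hi.
have hT h w : highest C h -> conn C h w -> top C (take k w) (take k h).
  by move=> hh hc; apply: conn_highest; [exact: take_highest|exact: conn_take].
have [_ e1] := tableau_of_phi (vt k _ v1) (hT _ _ hh1 c1).
have [_ e2] := tableau_of_phi (vt k _ v2) (hT _ _ hh2 c2).
rewrite -e1 // -e2 //; congr (phiw C i (can _)).
(* The sequence of shapes starts with the prefix of length 1, so the prefix of length k is recorded
   at position k-1. *)
have hk1 : k.-1 < size (iota 1 (size w1)) by rewrite size_iota; lia.
have := congr1 (fun t => nth (lab x0) t k.-1) E.
rewrite (nth_map 0) // (nth_map 0) -?sz // nth_iota; last by lia.
by rewrite add1n prednK //; case/andP: hk.
Qed.

End Components.

(** * Columns and shapes *)

Lemma adj_okE (r : rel letter) s : adj_ok r s = sorted r s.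
Proof.
elim: s => [|x [|y s] IH] //.
by rewrite -[RHS]/(r x y && sorted r (y :: s)) -IH.
Qed.

Lemma sorted_rcons2 (r : rel letter) s x y :
  sorted r (rcons (rcons s x) y) = sorted r (rcons s x) && r x y.
Proof. by case: s => [|a s] /=; rewrite ?andbT // rcons_path last_rcons. Qed.

Definition initial_column k : word := map L (iota 1 k).

Lemma initial_columnS k : initial_column k.+1 = rcons (initial_column k) (L k.+1).
Proof. by rewrite /initial_column -cats1 -(addn1 k) iotaD map_cat /= add1n addn1. Qed.

Lemma size_initial_column k : size (initial_column k) = k.
Proof. by rewrite size_map size_iota. Qed.

Section Columns.
Variable C : vcrystal.
Hypothesis Creg : regular C.
Variables (valid : pred letter) (r : rel letter).
Hypothesis valid_fw : forall i x y, idx C i -> cf C i x = Some y -> valid x = valid y.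
Hypothesis pair_fw : forall i x y x' y', idx C i -> valid x -> valid y ->
  fw C i [:: x; y] = Some [:: x'; y'] -> r x y = r x' y'.

Lemma conn_column u v : conn C u v ->
  all valid u && sorted r u -> all valid v && sorted r v.
Proof.
move=> huv; have [H _] : all valid u && sorted r u <-> all valid v && sorted r v; last exact: H.
apply: (conn_ind_inv (P := fun w => all valid w && sorted r w)) huv => i a b hi E.
have Eab : all valid a = all valid b.
  by apply: conn_valid valid_fw _ _ (conn_fw hi E).
rewrite -Eab; case: (boolP (all valid a)) => //= va.
by rewrite (fw_sorted _ va E) // => x y x' y' vx vy; exact: pair_fw.
Qed.

(** Iterating [conn_cat], the cuts between columns stay at fixed positions along a component, and
    each piece stays in the component of its own column. *)
Lemma split_columns (c : nat -> word) ks w : {in ks, forall k, size (c k) = k} ->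
  conn C (flatten (map c ks)) w ->
  exists ss, [/\ w = flatten ss, map size ss = ks &
    forall u, u \in ss -> exists2 k, k \in ks & conn C (c k) u].
Proof.
elim: ks w => [|k ks IH] w hs /= hc.
  by exists [::]; split=> //; move/conn_size: hc; case: w.
have [h1 h2] := conn_cat hc; rewrite hs ?mem_head // in h1 h2.
have [|ss [E1 E2 E3]] := IH (drop k w) _ h2.
  by move=> k' hk'; apply: hs; rewrite inE hk' orbT.
exists (take k w :: ss); split=> /=.
- by rewrite -E1 cat_take_drop.
- by rewrite E2 -(conn_size h1) hs ?mem_head.
- move=> u; rewrite inE => /orP [/eqP ->|/E3 [k' hk' hc']]; first by exists k; rewrite ?mem_head.
  by exists k' => //; rewrite inE hk' orbT.
Qed.

Lemma columns_str (c : nat -> word) (f : nat -> nat) i ks :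
  {in ks, forall k, epsw C i (c k) = 0 /\ phiw C i (c k) = f k} ->
  epsw C i (flatten (map c ks)) = 0 /\ phiw C i (flatten (map c ks)) = sumn (map f ks).
Proof.
elim: ks => [|k ks IH] H //=; have [e p] := H k (mem_head _ _).
have [|e' p'] := IH; first by move=> k' hk'; apply: H; rewrite inE hk' orbT.
by rewrite epsw_cat phiw_cat e e' p p'; lia.
Qed.

End Columns.

Definition partition_in n (Y : seq nat) := sorted geq Y && all (fun k => 0 < k <= n) Y.

Lemma partition_eq n Y Y' : partition_in n Y -> partition_in n Y' ->
  (forall i, 0 < i <= n -> count_mem i Y = count_mem i Y') -> Y = Y'.
Proof.
move=> /andP [s1 a1] /andP [s2 a2] H; apply: (sorted_eq (leT := geq)) => //.
- by move=> a b c /= h1 h2; exact: leq_trans h2 h1.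
- by move=> a b /= h; apply/eqP; rewrite eqn_leq andbC.
apply/allP => i _ /=; apply/eqP; case: (boolP (0 < i <= n)) => [/H //|hi].
by rewrite !(count_memPn _) //; apply: contra hi => h; [exact: (allP a2)|exact: (allP a1)].
Qed.

Lemma partition_ex n (m : nat -> nat) :
  exists2 Y, partition_in n Y & forall i, 0 < i <= n -> count_mem i Y = m i.
Proof.
have [Y aY cY] : exists2 Y, all (fun k => 0 < k <= n) Y &
    forall i, 0 < i <= n -> count_mem i Y = m i.
  elim: n => [|n [Y aY cY]]; first by exists [::] => // i; lia.
  exists (nseq (m n.+1) n.+1 ++ Y).
    rewrite all_cat all_nseq /= leqnn orbT /=; apply: sub_all aY => k /=; lia.
  move=> i hi; rewrite count_cat count_nseq /=; case: (eqVneq n.+1 i) => [<-|nin].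
    rewrite mul1n (count_memPn _) ?addn0 //; apply/negP => /(allP aY); lia.
  by rewrite mul0n cY //; lia.
exists (sort geq Y).
  by rewrite /partition_in sort_sorted /= ?all_sort // => a b /=; exact: leq_total.
by move=> i hi; rewrite count_sort cY.
Qed.

Lemma sumn_indicator (i : nat) Y : sumn (map (fun k => nat_of_bool (k == i)) Y) = count_mem i Y.
Proof. by elim: Y => [|k Y IH] //=; rewrite IH. Qed.

(** * Columns and shapes of type B *)

Section TypeB.
Variable n : nat.
Hypothesis hn : 2 <= n.
Let C := cB n.

Definition rB x y := (rankB n x < rankB n y) || (letter_eqb x Z && letter_eqb y Z).

Lemma columnBE c : columnB n c = (0 < size c) && (all (validB n) c && sorted rB c).
Proof. by rewrite /columnB adj_okE andbA. Qed.

Lemma validB_fw i x y : idx C i -> cf C i x = Some y -> validB n x = validB n y.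
Proof. by rewrite /idx /= => hi /fB_arrow []; rewrite /validB; lia. Qed.

Lemma letter_sepB x y : validB n x -> validB n y ->
  (forall i, idx C i -> phil C i x + epsl C i y = phil C i y + epsl C i x) -> x = y.
Proof.
have H' a b : (forall i, idx C i -> phil C i a + epsl C i b = phil C i b + epsl C i a) ->
  forall i, 1 <= i <= n -> phiB n i a + epsB n i b = phiB n i b + epsB n i a.
  by move=> H i hi; rewrite -!phil_B // -!epsl_B //; exact: H.
(* The coordinates of the weights at the indices [m] and [k] already separate the letters. *)
case: x => [m||m]; case: y => [k||k] //= hx hy /H' H.
- by have := H _ hx; have := H _ hy; rewrite /=; case: (ltngtP m k) => [| |->] //; lia.
- by have := H _ hx; rewrite /=; lia.
- by have := H _ hx; have := H _ hy; rewrite /=; lia.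
- by have := H _ hy; rewrite /=; lia.
- by have := H _ hy; rewrite /=; lia.
- by have := H _ hx; have := H _ hy; rewrite /=; lia.
- by have := H _ hx; rewrite /=; lia.
- by have := H _ hx; have := H _ hy; rewrite /=; case: (ltngtP m k) => [| |->] //; lia.
Qed.

(** The repetition of 0 in columns is forced here: colour n leads from [L n], [Z] through [Z], [Z]
    to [Z], [Bar n]. *)
Lemma pairB_fw i x y x' y' : idx C i -> validB n x -> validB n y ->
  fw C i [:: x; y] = Some [:: x'; y'] -> rB x y = rB x' y'.
Proof.
rewrite /idx => /= hi vx vy; rewrite sub0n addn0 phil_B // epsl_B //.
case: ifP => h.
  case E: (fB n i x) => [z|] //= [<- <-]; move/fB_arrow: E h.
  by case=> h0 /=; rewrite /rB; case: y vy => [m||m] /=; rewrite ?andbF ?orbF; lia.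
case: ifP => // _; case E: (fB n i y) => [z|] //= [<- <-]; move/fB_arrow: E h.
by case=> h0 /=; rewrite /rB; case: x vx => [m||m] /=; rewrite ?andbF ?orbF; lia.
Qed.

Lemma initial_columnB k : 0 < k <= n -> columnB n (initial_column k).
Proof.
move=> hk; rewrite columnBE size_initial_column; apply/and3P; split; first by lia.
  by rewrite all_map; apply/allP => i; rewrite mem_iota /= ; lia.
rewrite sorted_map; apply: sub_sorted (iota_ltn_sorted 1 k) => i j /= h.
by rewrite /rB /= h.
Qed.

(** Column weights in terms of fundamental weights: omega_n is the spin weight, and a column of
    height n has weight 2 omega_n. *)
Definition fundB i k := (k == i) * (if i == n then 2 else 1).

Lemma initial_column_strB i k : 0 < i <= n -> k <= n ->
  epsw C i (initial_column k) = 0 /\ phiw C i (initial_column k) = fundB i k.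
Proof.
rewrite /fundB => hi; elim: k => [|k IH] hk; first by case: i hi.
have [e p] := IH (ltnW hk).
rewrite initial_columnS -cats1 epsw_cat phiw_cat e p epsw1 phiw1 phil_B // epsl_B // /=.
by case: (eqVneq i n) => hin; lia.
Qed.

Definition canB Y : word := reading (TY Y).

Lemma canBE Y : canB Y = flatten (map initial_column (rev Y)).
Proof. by rewrite /canB /reading /TY map_rev. Qed.

Lemma canB_str Y i : partition_in n Y -> 0 < i <= n -> epsw C i (canB Y) = 0 /\
  phiw C i (canB Y) = count_mem i Y * (if i == n then 2 else 1).
Proof.
move=> /andP [_ /allP hY] hi; rewrite canBE.
have [|-> ->] := @columns_str C initial_column (fundB i) i (rev Y).
  by move=> k; rewrite mem_rev => /hY hk; apply: initial_column_strB => //; lia.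
split=> //; rewrite map_rev sumn_rev -sumn_indicator /fundB; elim: (Y) => [|k Y' IH] //=.
by rewrite IH mulnDl.
Qed.

(** Each letter has an even sum of phi and eps at colour n, so no spin weight occurs in words; half
    of this coordinate can then count columns of height n. *)
Lemma evenB h : highest C h -> ~~ odd (phiw C n h).
Proof.
move=> hh; have := phi_eps C n h; rewrite (highest_eps hh); last by rewrite /idx /=; lia.
have : ~~ odd (Phi C n h + Eps C n h).
  elim: h {hh} => [|x h IH] //; rewrite /Phi /Eps /= -/(Phi C n h) -/(Eps C n h).
  by rewrite phil_B // epsl_B //; case: x => [m||m] /=; lia.
lia.
Qed.

Lemma orthB_ok T : orthB n T -> partition_in n (Defs.shape T) /\ conn C (canB (Defs.shape T)) (reading T).
Proof.
case=> /andP [hc hs] [hk hT]; split=> //; rewrite /partition_in hs /=.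
apply/allP => k /mapP [c hcT ->]; rewrite (allP hk) ?map_f // andbT.
by have := allP hc c hcT; rewrite columnBE => /andP [].
Qed.

Lemma orthB_ex Y w : partition_in n Y -> conn C (canB Y) w ->
  exists T, [/\ orthB n T, Defs.shape T = Y & reading T = w].
Proof.
move=> hY; have /andP [sY /allP aY] := hY => hc; have := hc; rewrite canBE => /split_columns.
case; [by move=> k _; exact: size_initial_column|].
move=> ss [Ew Es Hs].
have Esh : Defs.shape (rev ss) = Y by rewrite /Defs.shape map_rev Es revK.
have Er : reading (rev ss) = w by rewrite /reading revK Ew.
exists (rev ss); split=> //; split; last split.
- rewrite /tabloid_ok Esh sY andbT all_rev; apply/allP => u /Hs [k].
  rewrite mem_rev => /aY hk huk; rewrite columnBE.
  have := initial_columnB hk; rewrite columnBE => /andP [h1 h2].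
  rewrite -(conn_size huk) h1 /=.
  exact: (conn_column validB_fw pairB_fw huk h2).
- by rewrite Esh; apply/allP => k /aY; lia.
- by rewrite Esh Er.
Qed.

Lemma conn_iff_QB w1 w2 : all (validB n) w1 -> all (validB n) w2 ->
  conn C w1 w2 <-> QB n w1 = QB n w2.
Proof.
apply: (@conn_iff_shapes C (regular_B hn) _ (@fw_htB n hn) _ (highest_iso_B hn) (validB n)
  validB_fw letter_sepB tabloid (seq nat) [::] Defs.shape reading (orthB n) (partition_in n) canB).
- by move=> w h h'; exact: top_unique_B.
- by move=> Y hY; apply: eps_highest => i hi; have [] := canB_str hY hi.
- exact: orthB_ok.
- exact: orthB_ex.
(* The number of columns of height i is the i-th coordinate of the weight, halved for i = n. *)
- move=> h _ hh; have [Y hY cY] := partition_ex n (fun i => if i == n then (phiw C n h)./2 else phiw C i h).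
  exists Y => // i hi; have [_ ->] := canB_str hY hi; rewrite cY //.
  by have := evenB hh; case: eqP => [->|]; lia.
- move=> Y Y' hY hY' H; apply: (partition_eq hY hY') => i hi.
  by have := H i hi; have [_ ->] := canB_str hY hi; have [_ ->] := canB_str hY' hi; case: ifP; lia.
Qed.

End TypeB.

(** * Columns and signed shapes of type D *)

Section TypeD.
Variable n : nat.
Hypothesis hn : 2 <= n.
Let C := cD n.

Definition rD x y := ~~ precD n y x.

Lemma columnDE c : columnD n c = (0 < size c) && (all (validD n) c && sorted rD c).
Proof. by rewrite /columnD adj_okE andbA. Qed.

Lemma validD_fw i x y : idx C i -> cf C i x = Some y -> validD n x = validD n y.
Proof. by rewrite /idx /= => hi /(fD_arrow hn) []; rewrite /validD; lia. Qed.

Lemma letter_sepD x y : validD n x -> validD n y ->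
  (forall i, idx C i -> phil C i x + epsl C i y = phil C i y + epsl C i x) -> x = y.
Proof.
have H' a b : (forall i, idx C i -> phil C i a + epsl C i b = phil C i b + epsl C i a) ->
  forall i, 1 <= i <= n -> phiD n i a + epsD n i b = phiD n i b + epsD n i a.
  by move=> H i hi; rewrite -!phil_D // -!epsl_D //; exact: H.
case: x => [m||m]; case: y => [k||k] //= hx hy /H' H.
- by have := H _ hx; have := H _ hy; rewrite /=; case: (ltngtP m k) => [| |->] //; lia.
- by have := H _ hx; have := H _ hy; rewrite /=; lia.
- by have := H _ hx; have := H _ hy; rewrite /=; lia.
- by have := H _ hx; have := H _ hy; rewrite /=; case: (ltngtP m k) => [| |->] //; lia.
Qed.

(** Incomparability of n and its bar is essential for stability: colour n leads from [L n.-1], [L n]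
    to [Bar n], [L n]. *)
Lemma pairD_fw i x y x' y' : idx C i -> validD n x -> validD n y ->
  fw C i [:: x; y] = Some [:: x'; y'] -> rD x y = rD x' y'.
Proof.
rewrite /idx => /= hi vx vy; rewrite sub0n addn0 phil_D // epsl_D //.
case: ifP => h.
  case E: (fD n i x) => [z|] //= [<- <-]; move/(fD_arrow hn): E h.
  by case=> h0 /=; rewrite /rD /precD; case: y vy => [m||m] //= hy hh; lia.
case: ifP => // _; case E: (fD n i y) => [z|] //= [<- <-]; move/(fD_arrow hn): E h.
by case=> h0 /=; rewrite /rD /precD; case: x vx => [m||m] //= hx hh; lia.
Qed.

Lemma initial_columnD k : 0 < k <= n -> columnD n (initial_column k).
Proof.
move=> hk; rewrite columnDE size_initial_column; apply/and3P; split; first by lia.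
  by rewrite all_map; apply/allP => i; rewrite mem_iota /= ; lia.
rewrite sorted_map; apply: sub_sorted (iota_ltn_sorted 1 k) => i j /= h.
by rewrite /rD /precD /=; lia.
Qed.

Definition minus_column k : word :=
  if k == n then rcons (initial_column n.-1) (Bar n) else initial_column k.

Lemma size_minus_column k : size (minus_column k) = k.
Proof.
rewrite /minus_column; case: eqP => [->|_]; rewrite ?size_rcons size_initial_column //; lia.
Qed.

Lemma minus_columnD k : 0 < k <= n -> columnD n (minus_column k).
Proof.
rewrite /minus_column; case: eqP => [_ _|_]; last exact: initial_columnD.
have hn1 : 0 < n.-1 <= n by lia.
move: (initial_columnD hn1); rewrite !columnDE size_rcons /= all_rcons.
have -> : n.-1 = n.-2.+1 by lia.
rewrite initial_columnS sorted_rcons2 => /and3P [_ -> ->] /=.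
rewrite /rD /precD /=; lia.
Qed.

(** A column of height n-1 has weight omega_(n-1) + omega_n, and one of height n has weight 2
    omega_n or, in the minus case, 2 omega_(n-1). *)
Definition fundD (i k : nat) : nat :=
  if i < n then nat_of_bool (k == i) else (k == n.-1) + (k == n).*2.
Definition fundDminus (i k : nat) : nat :=
  if k == n then (i == n.-1).*2 else fundD i k.

Lemma initial_column_strD i k : 0 < i <= n -> k <= n ->
  epsw C i (initial_column k) = 0 /\ phiw C i (initial_column k) = fundD i k.
Proof.
rewrite /fundD => hi; elim: k => [|k IH] hk.
  by split=> //=; case: ifP => h; lia.
have [e p] := IH (ltnW hk).
rewrite initial_columnS -cats1 epsw_cat phiw_cat e p epsw1 phiw1 phil_D // epsl_D // /=.
by case: (ltnP i n) => hin; split; lia.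
Qed.

Lemma minus_column_str i k : 0 < i <= n -> k <= n ->
  epsw C i (minus_column k) = 0 /\ phiw C i (minus_column k) = fundDminus i k.
Proof.
move=> hi hk; rewrite /minus_column /fundDminus; case: eqP => _; last exact: initial_column_strD.
have [|e p] := @initial_column_strD i n.-1 hi; first by lia.
rewrite -cats1 epsw_cat phiw_cat e p epsw1 phiw1 phil_D // epsl_D // /fundD /=.
by case: (ltnP i n) => hin; split; lia.
Qed.

Definition column_of (s : dsign) := if s is DMinus then minus_column else initial_column.
Definition fund_of (s : dsign) := if s is DMinus then fundDminus else fundD.

Definition canD (sh : dshape) : word :=
  if sh.2 is DMinus then reading (TYminus n sh.1) else reading (TY sh.1).

Lemma canDE sh : canD sh = flatten (map (column_of sh.2) (rev sh.1)).
Proof.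
rewrite /canD /column_of; case: sh.2; rewrite /reading /TY /TYminus -map_rev //.
Qed.

Definition okD (sh : dshape) : bool :=
  partition_in n sh.1 && (if sh.2 is DZero then n \notin sh.1 else n \in sh.1).

Lemma canD_str sh i : partition_in n sh.1 -> 0 < i <= n -> epsw C i (canD sh) = 0 /\
  phiw C i (canD sh) =
    if i < n.-1 then count_mem i sh.1
    else count_mem n.-1 sh.1 +
      (if (if sh.2 is DMinus then i == n.-1 else i == n) then (count_mem n sh.1).*2 else 0).
Proof.
move=> /andP [_ /allP hY] hi; rewrite canDE.
have [|-> ->] := @columns_str C (column_of sh.2) (fund_of sh.2 i) i (rev sh.1).
  move=> k; rewrite mem_rev => /hY /andP [_ hk].
  by rewrite /column_of /fund_of; case: sh.2;
    [exact: initial_column_strD|exact: minus_column_str|exact: initial_column_strD].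
split=> //; rewrite map_rev sumn_rev.
set b := if sh.2 is DMinus then i == n.-1 else i == n.
have pt k : fund_of sh.2 i k =
    if i < n.-1 then nat_of_bool (k == i) else (k == n.-1) + (if b then (k == n).*2 else 0).
  by rewrite /b /fund_of /fundDminus /fundD; case: (sh.2); do ?[case: ifP => ?]; lia.
rewrite (eq_map pt) => {pt}; case: (i < n.-1); last case: b;
  by elim: (sh.1) => [|k Y IH] //=; rewrite IH //; move: (count _ Y) => a; try (move: (count _ Y) => c); lia.
Qed.

(** No half-spin weight occurs in words, since each letter contributes evenly to the two last
    colours together. *)
Lemma evenD h : highest C h -> ~~ odd (phiw C n.-1 h + phiw C n h).
Proof.
move=> hh; have := phi_eps C n h; have := phi_eps C n.-1 h.
rewrite !(highest_eps hh); try by rewrite /idx /=; lia.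
have : ~~ odd (Phi C n.-1 h + Eps C n.-1 h + Phi C n h + Eps C n h).
  elim: h {hh} => [|x h IH] //; rewrite /Phi /Eps /= -/(Phi C n h) -/(Eps C n h)
    -/(Phi C n.-1 h) -/(Eps C n.-1 h).
  have : ~~ odd (phil C n.-1 x + epsl C n.-1 x + phil C n x + epsl C n x).
    rewrite !phil_D // !epsl_D //; case: x => [m||m] //=; lia.
  move: IH; lia.
lia.
Qed.

Lemma orthD_ok (p : tabloid * dshape) : orthD n p.1 p.2 ->
  okD p.2 /\ conn C (canD p.2) (reading p.1).
Proof.
case: p => T [Y s] /= [/andP [hc hs] [hk [/= EY hT]]].
rewrite /okD /canD /= EY /partition_in hs /= in hT *.
have -> : all (fun k => 0 < k <= n) (Defs.shape T).
  apply/allP => k /mapP [c hcT ->]; rewrite (allP hk) ?map_f // andbT.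
  by have := allP hc c hcT; rewrite columnDE => /andP [].
by case: s hT => -[].
Qed.

Lemma orthD_ex sh w : okD sh -> conn C (canD sh) w ->
  exists p : tabloid * dshape, [/\ orthD n p.1 p.2, p.2 = sh & reading p.1 = w].
Proof.
move=> /andP [hY hs]; have /andP [sY /allP aY] := hY => hc; have := hc; rewrite canDE => /split_columns.
case; first by move=> k _; rewrite /column_of; case: sh.2;
  rewrite ?size_initial_column ?size_minus_column.
move=> ss [Ew Es Hs].
have Esh : Defs.shape (rev ss) = sh.1 by rewrite /Defs.shape map_rev Es revK.
have Er : reading (rev ss) = w by rewrite /reading revK Ew.
exists (rev ss, sh); split=> //; split; last split; last split; rewrite /= ?Esh //.
- rewrite /tabloid_ok Esh sY andbT all_rev; apply/allP => u /Hs [k].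
  rewrite mem_rev => /aY hk huk; rewrite columnDE.
  have : columnD n (column_of sh.2 k).
    by rewrite /column_of; case: sh.2; [exact: initial_columnD|exact: minus_columnD|exact: initial_columnD].
  rewrite columnDE => /andP [h1 h2]; rewrite -(conn_size huk) h1 /=.
  exact: (conn_column validD_fw pairD_fw huk h2).
- by apply/allP => k /aY; lia.
- by rewrite Er; move: hs hc; rewrite /canD; case: sh.2.
Qed.

Lemma conn_iff_QD w1 w2 : all (validD n) w1 -> all (validD n) w2 ->
  conn C w1 w2 <-> QD n w1 = QD n w2.
Proof.
apply: (@conn_iff_shapes C (regular_D hn) _ (@fw_htD n hn) _ (highest_iso_D hn) (validD n)
  validD_fw letter_sepD (tabloid * dshape)%type dshape ([::], ([::], DZero)) snd
  (fun p => reading p.1) (fun p => orthD n p.1 p.2) okD canD).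
- by move=> w h h'; exact: top_unique_D.
- by move=> sh /andP [hY _]; apply: eps_highest => i hi; have [] := canD_str hY hi.
- exact: orthD_ok.
- exact: orthD_ex.
- move=> h _ hh; set p := phiw C n.-1 h; set q := phiw C n h.
  have ev : ~~ odd (p + q) := evenD hh.
  (* The common part of the last two coordinates counts the columns of height n-1; half of their
     difference counts those of height n, and the larger coordinate decides the sign. *)
  have [Y hY cY] := partition_ex n (fun i => if i < n.-1 then phiw C i h
    else if i < n then minn p q else (maxn p q - minn p q)./2).
  have cn : count_mem n Y = (maxn p q - minn p q)./2.
    by rewrite cY; [rewrite ltnn ifF //|]; lia.
  have cn1 : count_mem n.-1 Y = minn p q.
    by rewrite cY; [rewrite ltnn ifT //|]; lia.
  exists (Y, if p < q then DPlus else if q < p then DMinus else DZero).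
    rewrite /okD hY /= -!has_pred1 !has_count cn.
    by case: (ltngtP p q) => hpq /=; lia.
  move=> i hi; have [_ ->] := @canD_str (Y, if p < q then DPlus else if q < p then DMinus else DZero) i hY hi.
  rewrite /= cn cn1; case: (ltnP i n.-1) => hi1; first by rewrite cY // hi1.
  have [Ei|Ei] : i = n.-1 \/ i = n by move: hi; rewrite /idx /=; lia.
    by rewrite Ei -/p; case: (ltngtP p q) => hpq /=; rewrite ?eqxx ?ifF; lia.
  by rewrite Ei -/q; case: (ltngtP p q) => hpq /=; rewrite ?eqxx ?ifF; lia.
- move=> [Y s] [Y' s'] /andP [/= hY hs] /andP [/= hY' hs'] H.
  have H' i : 0 < i <= n -> phiw C i (canD (Y, s)) = phiw C i (canD (Y', s')) by exact: H.
  have cn (Y0 : seq nat) : n \in Y0 -> 0 < count_mem n Y0 by rewrite -has_count has_pred1.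
  have cn0 (Y0 : seq nat) : n \notin Y0 -> count_mem n Y0 = 0 by move/count_memPn.
  have hn1 : 0 < n.-1 <= n by lia.
  have hnn : 0 < n <= n by lia.
  have e i : 0 < i < n.-1 -> count_mem i Y = count_mem i Y'.
    move=> hi; have hi' : 0 < i <= n by lia.
    have hlt : i < n.-1 by lia.
    by have := H' i hi'; have [_ ->] := @canD_str (Y, s) i hY hi';
      have [_ ->] := @canD_str (Y', s') i hY' hi'; rewrite hlt.
  have := H' _ hn1; have := H' _ hnn.
  have [_ ->] := @canD_str (Y, s) _ hY hn1; have [_ ->] := @canD_str (Y, s) _ hY hnn.
  have [_ ->] := @canD_str (Y', s') _ hY' hn1; have [_ ->] := @canD_str (Y', s') _ hY' hnn.
  have f1 : (n < n.-1) = false by lia.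
  have f2 : (n == n.-1) = false by lia.
  have f3 : (n.-1 == n) = false by lia.
  rewrite /= ltnn f1 f2 f3 !eqxx => e1 e2.
  have cs (s0 : dsign) (Y0 : seq nat) : (if s0 is DZero then n \notin Y0 else n \in Y0) ->
      if s0 is DZero then count_mem n Y0 == 0 else 0 < count_mem n Y0.
    by case: s0 => [/cn|/cn|/cn0 ->].
  (* Conversely, the smaller of the last two coordinates gives the columns of height n-1. Since a
     nonzero sign comes with at least one column of height n, the excess determines the sign and the
     number of these columns. *)
  have [es en en1] : [/\ s = s', count_mem n Y = count_mem n Y' &
      count_mem n.-1 Y = count_mem n.-1 Y'].
    clear H H'; move: (cs s Y hs) (cs s' Y' hs') e1 e2; clear hs hs'.
    by case: s; case: s' => /= *; split=> //; lia.
  rewrite es; congr pair; apply: (partition_eq hY hY') => i hi.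
  have [h|[->|->]] : i < n.-1 \/ i = n.-1 \/ i = n by lia.
  + by apply: e; lia.
  + exact: en1.
  + exact: en.
Qed.

End TypeD.

Theorem mainTheorem11 (n : nat) (hn : 2 <= n) :
  (forall w1 w2 : word, all (validB n) w1 -> all (validB n) w2 ->
     (conn (cB n) w1 w2 <-> QB n w1 = QB n w2)) /\
  (forall w1 w2 : word, all (validD n) w1 -> all (validD n) w2 ->
     (conn (cD n) w1 w2 <-> QD n w1 = QD n w2)).
Proof. by split=> w1 w2; [exact: conn_iff_QB|exact: conn_iff_QD]. Qed.
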